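(* Let $\varrho$ be a primitive substitution on a compact Hausdorff alphabet $\mathcal{A}$, with corresponding subshift $X_\varrho$ and substitution operator $M$. Let $r$ be the spectral radius of $M$. If $T = M/r$ is strongly power convergent, then $X_\varrho$ is uniquely ergodic, i.e. there is exactly one $\sigma$-invariant regular Borel probability measure on $X_\varrho$.
   Context: Alphabets and substitutions. $\mathcal{A}$ is a compact Hausdorff space whose elements are called letters. $\mathcal{A}^+ = \bigsqcup_{n\ge 1}\mathcal{A}^n$ is the space of non-empty finite words (disjoint union of spaces with product topologies), $\mathcal{A}^* = \mathcal{A}^+\sqcup\{\varepsilon\}$ with $\varepsilon$ the empty word, $|u|$ is the length of a word $u$, and $u\triangleleft v$ means that $u$ is a (contiguous) subword of $v$. A substitution is a continuous map $\varrho\colon\mathcal{A}\to\mathcal{A}^+$; it extends to words by concatenation, $\varrho(u_1\cdots u_n)=\varrho(u_1)\cdots\varrho(u_n)$, and so can be iterated. Standing assumption: $|\varrho(a)|\ge 2$ for some $a\in\mathcal{A}$. Primitive: for every non-empty open $U\subseteq\mathcal{A}$ there is $p\ge 0$ such that for all $a\in\mathcal{A}$ some letter of $\varrho^p(a)$ is in $U$. Subshift. A word is generated by $\varrho$ if it is a subword of $\varrho^k(a)$ for some $a\in\mathcal{A}$, $k\ge 0$. $\mathcal{L}(\varrho)\subseteq\mathcal{A}^*$ is the closure of the set of generated words. $X_\varrho$ is the set of all $w\in\mathcal{A}^{\mathbb{Z}}$ (product topology) all of whose finite subwords lie in $\mathcal{L}(\varrho)$, with the shift $\sigma(x)_i=x_{i+1}$.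 Substitution operator. $E=C(\mathcal{A})$ is the Banach space of continuous functions $\mathcal{A}\to\mathbb{R}$ with the supremum norm. $M\colon E\to E$ is the bounded operator $(Mf)(a)=\sum_{b\triangleleft\varrho(a)}f(b)$, summing over all letters of $\varrho(a)$ with multiplicity. $r$ is its spectral radius. Strongly power convergent: $\lim_{n\to\infty}T^n(f)$ exists in $E$ (in norm) for every $f\in E$. *)

(* Defs.v *)
From HB Require Import structures.
From mathcomp Require Import all_boot all_order all_algebra.
From mathcomp Require Import complex.
From mathcomp Require Import all_classical all_reals all_analysis.
Set Implicit Arguments.
Unset Strict Implicit.
Unset Printing Implicit Defensive.
Import Order.TTheory GRing.Theory Num.Theory.
Import numFieldNormedType.Exports.
Local Open Scope classical_set_scope.
Local Open Scope ring_scope.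

HB.mixin Record isCompactHausdorff T & Topological T := {
  compactT : compact [set: T];
  hausdorffT : hausdorff_space T
}.

#[short(type="compactHausdorffType")]
HB.structure Definition CompactHausdorff :=
  {T of Topological T & isCompactHausdorff T}.

(** * Words and substitutions *)

(* [word A] is the space A^* of all finite words, the disjoint union over
   n >= 0 of the product spaces A^n; [letters] is the bijection with that
   disjoint union. The space A^+ is its open and closed subspace of words
   other than [::]. *)
Definition word (A : Type) : Type := seq A.

Definition letters (A : topologicalType) (w : word A) :
    {n : nat & {ptws 'I_n -> A}} :=
  existT (fun n => {ptws 'I_n -> A}) (size w) (tnth (in_tuple w)).

HB.instance Definition _ (A : choiceType) := Choice.copy (word A) (seq A).
HB.instance Definition _ (A : topologicalType) :=
  Topological.copy (word A) (initial_topology (@letters A)).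

Record substitution (A : topologicalType) := Substitution {
  subst_fun :> A -> word A;
  subst_neq0 : forall a, subst_fun a != [::];
  subst_continuous : continuous subst_fun
}.

Section Substitutions.
Variables (A : topologicalType) (rho : substitution A).

Definition subst_word (u : word A) : word A := flatten (map rho u).

Definition subst_iter (k : nat) (a : A) : word A := iter k subst_word [:: a].

Definition primitive_subst : Prop :=
  forall U : set A, open U -> U !=set0 ->
    exists p : nat, forall a : A, exists2 b, b \in subst_iter p a & U b.

Definition generated : set (word A) :=
  [set u | exists (a : A) (k : nat), infix u (subst_iter k a)].

Definition language : set (word A) := closure generated.

Definition factor (x : {ptws int -> A}) (i : int) (n : nat) : word A :=
  [seq x (i + j%:Z) | j <- iota 0 n].

Definition left_shift (x : {ptws int -> A}) : {ptws int -> A} :=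
  fun i => x (i + 1).

Definition subshift : set {ptws int -> A} :=
  [set x | forall i n, language (factor x i n)].

Lemma subshift_shift x : subshift x -> subshift (left_shift x).
Proof.
move=> xX i n; have -> : factor (left_shift x) i n = factor x (i + 1) n.
  by apply: eq_map => j; rewrite /left_shift addrAC.
exact: xX.
Qed.

(* [subshift] coerces to its subtype, with the subspace topology. *)
Definition subshift_map (x : subshift) : subshift :=
  exist _ (left_shift (val x)) (mem_set (subshift_shift (set_valP x))).

End Substitutions.

(** * The Banach space C(A) *)

Definition is_cfun (R : realType) (A : topologicalType) : {pred A -> R} :=
  mem [set f : A -> R | continuous f].

Record cfun (R : realType) (A : compactHausdorffType) := CFun {
  cfun_val :> A -> R;
  cfun_valP : cfun_val \in @is_cfun R A
}.

Section ContinuousFunctions.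
Variables (R : realType) (A : compactHausdorffType).

HB.instance Definition _ := [isSub for @cfun_val R A].
HB.instance Definition _ := [Choice of cfun R A by <:].

Lemma is_cfun_submod : submod_closed (@is_cfun R A).
Proof.
split; first by apply/mem_set => x; exact: cvg_cst.
move=> c f g /set_mem fc /set_mem gc; apply/mem_set => x.
by apply: cvgD; [apply: cvgZr; exact: fc|exact: gc].
Qed.

HB.instance Definition _ :=
  GRing.isSubmodClosed.Build R (A -> R) (@is_cfun R A) is_cfun_submod.
HB.instance Definition _ := [SubChoice_isSubLmodule of cfun R A by <:].

Lemma cfun_continuous (f : cfun R A) : continuous f.
Proof. exact: set_mem (cfun_valP f). Qed.

Definition sup_norm (f : cfun R A) : R := sup [set `|f a| | a in [set: A]].

Lemma sup_norm_has_ub (f : cfun R A) : has_ubound [set `|f a| | a in [set: A]].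
Proof.
have cK : compact (range f).
  apply: continuous_compact (@compactT A).
  by apply: continuous_subspaceT; exact: cfun_continuous.
have [M [_ MP]] := compact_bounded cK.
exists (M + 1) => _ [a _ <-].
by apply: (MP (M + 1)); [rewrite ltrDl|exists a].
Qed.

Lemma le_sup_norm (f : cfun R A) a : `|f a| <= sup_norm f.
Proof. by apply: ub_le_sup; [exact: sup_norm_has_ub|exists a]. Qed.

Lemma sup_norm_le (f : cfun R A) c :
  0 <= c -> (forall a, `|f a| <= c) -> sup_norm f <= c.
Proof.
move=> c0 fc; have [ne|/set0P/negP/negbNE/eqP e0] :=
    pselect ([set `|f a| | a in [set: A]] !=set0).
  by apply: ge_sup => // _ [a _ <-].
by rewrite /sup_norm e0 sup0.
Qed.

Lemma sup_norm_ge0 (f : cfun R A) : 0 <= sup_norm f.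
Proof.
have [[_ [a _ _]]|/set0P/negP/negbNE/eqP e0] :=
    pselect ([set `|f a| | a in [set: A]] !=set0).
  exact: le_trans (le_sup_norm f a).
by rewrite /sup_norm e0 sup0.
Qed.

Lemma sup_normD (f g : cfun R A) : sup_norm (f + g) <= sup_norm f + sup_norm g.
Proof.
apply: sup_norm_le => [|a]; first by rewrite addr_ge0 ?sup_norm_ge0.
by apply: le_trans (ler_normD _ _) _; rewrite lerD ?le_sup_norm.
Qed.

Lemma sup_norm_eq0 (f : cfun R A) : sup_norm f = 0 -> f = 0.
Proof.
move=> f0; apply/val_inj/funext => a; apply/eqP.
by rewrite -normr_le0 -f0 le_sup_norm.
Qed.

Lemma sup_normZ (c : R) (f : cfun R A) : sup_norm (c *: f) = `|c| * sup_norm f.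
Proof.
have leZ d (g : cfun R A) : sup_norm (d *: g) <= `|d| * sup_norm g.
  apply: sup_norm_le => [|a]; first by rewrite mulr_ge0 ?sup_norm_ge0.
  apply: le_trans (_ : `|d * g a| <= _) => //.
  by rewrite normrM ler_wpM2l ?le_sup_norm.
apply/eqP; rewrite eq_le leZ /=.
have [->|c0] := eqVneq c 0; first by rewrite normr0 mul0r sup_norm_ge0.
rewrite -ler_pdivlMl ?normr_gt0 // -normfV.
by rewrite -{1}[f](scalerK c0) leZ.
Qed.

HB.instance Definition _ :=
  Lmodule_isNormed.Build R (cfun R A) sup_normD sup_normZ sup_norm_eq0.

End ContinuousFunctions.

(** * The substitution operator *)

Section SubstitutionOperator.
Variables (R : realType) (A : compactHausdorffType) (rho : substitution A).

Lemma sum_letters_continuous (f : A -> R) :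
  continuous f -> continuous (fun w : word A => \sum_(b <- w) f b).
Proof.
move=> fc.
pose s n (x : {ptws 'I_n -> A}) : R := \sum_(i < n) f (x i).
pose t (v : {n : nat & {ptws 'I_n -> A}}) := s (projT1 v) (projT2 v).
have tc : continuous t.
  apply: (@sigT_continuous _ (fun n => {ptws 'I_n -> A}) _ s) => n.
  apply: continuous_big => [|i _ x]; first exact: add_continuous.
  apply: continuous_comp; last exact: fc.
  exact: (@proj_continuous _ (fun=> A) i).
have -> : (fun w : word A => \sum_(b <- w) f b) = t \o @letters A.
  by apply/funext => w; rewrite /t /s /= big_tnth.
move=> w; apply: continuous_comp; last exact: tc.
exact: (@initial_continuous _ _ (@letters A)).
Qed.

Lemma subst_op_subproof (f : cfun R A) :
  (fun a => \sum_(b <- rho a) f b) \in @is_cfun R A.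
Proof.
apply/mem_set => a.
apply: (continuous_comp (f := rho) (g := fun w : word A => \sum_(b <- w) f b)).
  exact: subst_continuous.
exact/sum_letters_continuous/cfun_continuous.
Qed.

Definition subst_op (f : cfun R A) : cfun R A := CFun (subst_op_subproof f).

End SubstitutionOperator.

(** * Spectral radius and power convergence *)

Section Operators.
Variables (R : realType) (V : normedModType R) (T : V -> V).

(* V * V is the complexification V + iV of the real space V (with a norm
   equivalent to any of the usual ones), on which [complex_scale] is the
   multiplication by complex scalars and [complex_extension] extends T. *)
Definition complex_scale (z : complex R) (u : V * V) : V * V :=
  (complex.Re z *: u.1 - complex.Im z *: u.2,
   complex.Im z *: u.1 + complex.Re z *: u.2).

Definition complex_extension (u : V * V) : V * V := (T u.1, T u.2).

Definition resolvent_set : set (complex R) :=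
  [set z | exists S : V * V -> V * V,
     [/\ continuous S,
         cancel S (fun u => complex_scale z u - complex_extension u) &
         cancel (fun u => complex_scale z u - complex_extension u) S]].

Definition spectrum : set (complex R) := ~` resolvent_set.

Definition spectral_radius : R :=
  sup [set Normc.normc z | z in spectrum].

Definition strongly_power_convergent : Prop :=
  forall f : V, cvgn (fun n => iter n T f).

End Operators.

(** * Unique ergodicity *)

(* The measurable types of the library are pointed: [borel x0] is X with its
   Borel sigma-algebra, pointed at x0. The choice of x0 is immaterial, and its
   existence is implied by that of a probability measure on X. *)
Definition pointed_at (X : topologicalType) (x0 : X) : Type := X.

HB.instance Definition _ (X : topologicalType) (x0 : X) :=
  Topological.copy (pointed_at x0) X.
HB.instance Definition _ (X : topologicalType) (x0 : X) :=
  isPointed.Build (pointed_at x0) x0.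

Definition borel (X : topologicalType) (x0 : X) :=
  g_sigma_algebraType (@open (pointed_at x0)).
HB.instance Definition _ (X : topologicalType) (x0 : X) :=
  Measurable.on (borel x0).

Section UniqueErgodicity.
Variables (R : realType) (X : topologicalType).

Definition regular_measure (x0 : X) (mu : probability (borel x0) R) : Prop :=
  forall B : set (borel x0), measurable B ->
    mu B = ereal_inf [set mu U | U in [set U : set X | open U /\ B `<=` U]] /\
    mu B = ereal_sup [set mu K | K in [set K : set X | compact K /\ K `<=` B]].

Definition invariant_measure (f : X -> X) (x0 : X)
    (mu : probability (borel x0) R) : Prop :=
  forall B : set (borel x0), measurable B -> mu (f @^-1` B) = mu B.

Definition uniquely_ergodic (f : X -> X) : Prop :=
  exists (x0 : X) (mu : probability (borel x0) R),
    [/\ regular_measure mu, invariant_measure f mu &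
        forall nu : probability (borel x0) R,
          regular_measure nu -> invariant_measure f nu ->
          forall B : set (borel x0), measurable B -> nu B = mu B].

End UniqueErgodicity.

(* Main.v *)
(** The operator M is positive, so its growth is that of the functions
M^n 1, and r is exactly the infimum q of their exponential growth rates: q
lies in the spectrum, since otherwise the Neumann sums at real l > q would
stay bounded as l decreases to q and M would grow at a rate < q. Hence T^n 1
does not tend to 0, and by primitivity h = lim T^n 1 is a strictly positive
function which spans the fixed space of T. If S is a continuous real function
on words which is additive up to a bounded error, then r^-n S(rho^n(a))
converges uniformly in a; the limit is a fixed point of T, hence c h, while
r^-n |rho^n(a)| converges to h. So S(rho^n(a)) / |rho^n(a)| converges to c
uniformly in a, and S(u) / |u| is close to c for all long words u of the
language. For cylinder functions F, the sum of F along a word is such an S,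
and so the Birkhoff averages of every continuous function converge uniformly
on the subshift to a constant. This forces uniqueness of the invariant
measure. Existence is the Krylov-Bogoliubov argument: a limit along an
ultrafilter of the empirical measures of an orbit is a finitely additive
invariant content on all subsets, and its regularization is an invariant
regular Borel probability measure. *)

From HB Require Import structures.
Require Import Defs.
From mathcomp Require Import all_boot all_order all_algebra.
From mathcomp Require Import complex.
From mathcomp Require Import all_classical all_reals all_analysis.
From mathcomp Require Import measurable_realfun.
From mathcomp Require Import ring lra zify.
Set Implicit Arguments.
Unset Strict Implicit.
Unset Printing Implicit Defensive.
Import Order.TTheory GRing.Theory Num.Theory.
Import numFieldNormedType.Exports.
Local Open Scope classical_set_scope.
Local Open Scope ring_scope.

(** * Topology of words *)

Lemma cvg_ptws (I : eqType) (T : topologicalType) (F : set_system {ptws I -> T})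
    (f : {ptws I -> T}) :
  Filter F -> (forall i, (fun g : {ptws I -> T} => g i) @ F --> f i) -> F --> f.
Proof.
move=> FF cF; apply/cvg_sup => i; apply/cvg_image.
  by rewrite eqEsubset; split => // t _; exists (fun=> t).
move=> U /cF FU; exists ((fun g : {ptws I -> T} => g i) @^-1` U) => //.
by rewrite eqEsubset; split => [t [g Ug <-]//|t Ut]; exists (fun=> t).
Qed.

Lemma continuous_ptws (I : eqType) (S T : topologicalType)
    (f : S -> {ptws I -> T}) :
  (forall i, continuous (fun s => f s i)) -> continuous f.
Proof. by move=> cf s; apply: cvg_ptws => i; exact: cf. Qed.

Lemma ptws_eval_continuous (I : eqType) (T : topologicalType) (i : I) :
  continuous (fun f : {ptws I -> T} => f i).
Proof. exact: (@proj_continuous _ (fun=> T) i). Qed.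

Lemma cvg_near_eq (T : Type) (V : topologicalType) (F : set_system T)
    (f g : T -> V) (l : V) : Filter F ->
  (\forall t \near F, f t = g t) -> g @ F --> l -> f @ F --> l.
Proof.
move=> FF fg gl; apply: cvg_trans gl; apply: near_eq_cvg.
by apply: filterS fg => t.
Qed.

Section WordTopology.
Variables (A : topologicalType).
Implicit Types (u v w : word A) (a : A).

Lemma lettersE a n v : size v = n ->
  letters v = existT (fun n => {ptws 'I_n -> A}) n (fun i => nth a v i).
Proof.
by move=> <-; congr existT; apply/funext => i; rewrite (tnth_nth a).
Qed.

(** Once the lengths agree with that of [w], the words stay in one summand of the disjoint union,
    whose topology is that of coordinatewise convergence; [a] is the default value of [nth]. *)
Lemma cvg_word a (T : Type) (F : set_system T) (f : T -> word A) w :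
  Filter F -> (\forall t \near F, size (f t) = size w) ->
  (forall i, (i < size w)%N -> (fun t => nth a (f t) i) @ F --> nth a w i) ->
  f @ F --> w.
Proof.
move=> FF Fs Fn U [_ [[B oB <-] Bw BU]].
pose g t : {ptws 'I_(size w) -> A} := fun i => nth a (f t) i.
have gF : g @ F --> ((fun i : 'I_(size w) => nth a w i) : {ptws 'I_(size w) -> A}).
  by apply: cvg_ptws => i; exact: Fn.
rewrite nbhs_simpl.
have FB : \forall t \near F, B (existT _ (size w) (g t)).
  have : nbhs (letters w) B by exact: open_nbhs_nbhs.
  by rewrite (lettersE a erefl) => /gF.
by apply: filterS2 Fs FB => t st Bt; apply: BU; rewrite /= (lettersE a st).
Qed.

Lemma size_near w : \forall v \near w, size v = size w.
Proof.
have lw : @letters A @ w --> letters w.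
  exact: (@initial_continuous _ _ (@letters A)).
apply: (lw [set x | projT1 x = size w]).
change (nbhs (tnth (in_tuple w) : {ptws 'I_(size w) -> A}) [set x | size w = size w]).
exact: filterS filterT.
Qed.

Lemma cvg_size_near (T : Type) (F : set_system T) (f : T -> word A) u :
  Filter F -> f @ F --> u -> \forall t \near F, size (f t) = size u.
Proof.
by move=> FF fu; apply: (fu [set v | size v = size u]); exact: size_near.
Qed.

Lemma nth_continuous a i : continuous (fun w => nth a w i).
Proof.
move=> w; have [wi|iw] := leqP (size w) i.
  apply: (@cvg_near_cst _ _ (nth a w i) _ (nbhs w)).
  have := size_near w; apply: filterS => v vw.
  by rewrite !nth_default ?vw.
(* [insub] turns [i] into an index of the summand at hand; summands of too short words take the
   default value [a]. *)
pose t (v : {n : nat & {ptws 'I_n -> A}}) : A :=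
  if insub i : option 'I_(projT1 v) is Some j then projT2 v j else a.
have tc : continuous t.
  apply: (@sigT_continuous _ (fun n => {ptws 'I_n -> A}) _
    (fun n x => if insub i : option 'I_n is Some j then x j else a)) => n.
  by case: insubP => [j _ _|_]; [exact: ptws_eval_continuous|exact: cst_continuous].
have -> : (fun w => nth a w i) = t \o @letters A.
  apply/funext => v; rewrite /t /=; case: insubP => [j _ <-|].
    by rewrite (tnth_nth a).
  by rewrite -leqNgt => ?; rewrite nth_default.
apply: continuous_comp; last exact: tc.
exact: (@initial_continuous _ _ (@letters A)).
Qed.

Lemma cvg_cat (T : Type) (F : set_system T) (f g : T -> word A) u v :
  Filter F -> f @ F --> u -> g @ F --> v ->
  (fun t => f t ++ g t : word A) @ F --> (u ++ v : word A).
Proof.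
move=> FF fu gv.
(* [nth] needs a default letter; over an empty alphabet the only word is [[::]]. *)
have [[a _]|nA] := pselect (exists a : A, True).
  have fs : \forall t \near F, size (f t) = size u by exact: cvg_size_near fu.
  have gs : \forall t \near F, size (g t) = size v by exact: cvg_size_near gv.
  apply: (@cvg_word a).
    by apply: filterS2 fs gs => t ft gt; rewrite !size_cat ft gt.
  move=> i _; rewrite nth_cat.
  apply: (@cvg_near_eq _ _ _ _ (fun t => if (i < size u)%N then nth a (f t) i
      else nth a (g t) (i - size u))).
    by apply: filterS fs => t ft; rewrite nth_cat ft.
  case: ifPn => _.
    exact: (continuous_cvg FF (@nth_continuous a i u) fu).
  exact: (continuous_cvg FF (@nth_continuous a _ v) gv).
have nil w : w = [::] by case: w => // a; case: nA; exists a.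
rewrite (nil (u ++ v)); apply: (@cvg_near_cst T (word A) [::] _ F).
by apply: nearW => t; exact: nil.
Qed.

Lemma subst_word_continuous (rho : substitution A) : continuous (subst_word rho).
Proof.
move=> w; case: w => [|a w].
  apply: (@cvg_near_cst _ (word A) [::] _ (nbhs ([::] : word A))).
  have := size_near ([::] : word A); apply: filterS => v.
  by move=> /size0nil ->.
set w' : word A := a :: w.
(* For fixed [n] this is a concatenation of [n] continuous maps, and near [w'] the length of the
   argument is constant. The first letter [a] of [w'] serves as default. *)
pose g n v : word A := flatten [seq rho (nth a v i) | i <- iota 0 n].
have gc n : {for w', continuous (g n)}.
  elim: n => [|n IH]; first exact: (@cst_continuous (word A) (word A) [::] w').
  rewrite (_ : g n.+1 = fun v => g n v ++ rho (nth a v n) : word A); last first.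
    by apply/funext => v; rewrite /g -addn1 iotaD map_cat flatten_cat /= cats0.
  apply: (cvg_cat _ IH).
  exact: (continuous_cvg _ (@subst_continuous _ rho _) (@nth_continuous a n w')).
have gE v : subst_word rho v = g (size v) v.
  rewrite /subst_word /g; congr flatten.
  by apply: (@eq_from_nth _ [::]); rewrite ?size_map ?size_iota// => i iv;
     rewrite (nth_map a)// (nth_map 0%N) ?size_iota// nth_iota.
rewrite (_ : subst_word rho = fun v => g (size v) v); last exact/funext.
apply: (@cvg_near_eq (word A) (word A) (nbhs w') _ (g (size w'))); last exact: gc.
by have := size_near w'; apply: filterS => v ->.
Qed.

Lemma subst_iter_continuous (rho : substitution A) n :
  continuous (subst_iter rho n).
Proof.
elim: n => [|n IH] a /=.
  apply: (@cvg_word a); first exact: nearW.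
  by case=> // _; exact: cvg_id.
apply: (@continuous_comp _ _ _ (subst_iter rho n)); first exact: IH.
exact: subst_word_continuous.
Qed.

End WordTopology.

(** * Iterated substitutions and their block decompositions *)

Section WordCombinatorics.
Variables (A : topologicalType) (rho : substitution A).
Implicit Types (u v w : word A) (a : A).

Lemma subst_word_cat u v : subst_word rho (u ++ v) = subst_word rho u ++ subst_word rho v.
Proof. by rewrite /subst_word map_cat flatten_cat. Qed.

Lemma iter_subst_word_flatten n w :
  iter n (subst_word rho) w = flatten [seq subst_iter rho n a | a <- w].
Proof.
have iter_cat u v : iter n (subst_word rho) (u ++ v) =
    iter n (subst_word rho) u ++ iter n (subst_word rho) v.
  by elim: n => //= n ->; rewrite subst_word_cat.
elim: w => [|a w IH] /=; first by elim: n {iter_cat} => //= n ->.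
by rewrite -cat1s iter_cat IH.
Qed.

Lemma subst_iterD m n a : subst_iter rho (m + n) a =
  flatten [seq subst_iter rho m b | b <- subst_iter rho n a].
Proof. by rewrite /subst_iter iterD iter_subst_word_flatten. Qed.

Lemma subst_iter1 a : subst_iter rho 1 a = rho a.
Proof. by rewrite /subst_iter /= /subst_word /= cats0. Qed.

Lemma size_subst_iter_gt0 n a : (0 < size (subst_iter rho n a))%N.
Proof.
elim: n a => // n IH a; rewrite -[n.+1]addn1 subst_iterD subst_iter1.
have := subst_neq0 rho a; case: (rho a : seq A) => // b w _ /=.
by rewrite size_cat addn_gt0 IH.
Qed.

Lemma leq_size_subst_iter a m n : (m <= n)%N ->
  (size (subst_iter rho m a) <= size (subst_iter rho n a))%N.
Proof.
move=> /subnK <-; elim: (n - m)%N => // k IH; apply: leq_trans IH _.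
rewrite addSn -[(k + m).+1]add1n (subst_iterD 1) size_flatten /shape -map_comp.
elim: (subst_iter rho (k + m) a : seq A) => //= b w IHw.
exact: leq_add (size_subst_iter_gt0 1 b) IHw.
Qed.

End WordCombinatorics.

(** The outermost operator sums over the letters [c] of [sigma b], and [sigma^(n+1)(b)] is the
    concatenation of the words [sigma^n(c)]. For [f = 1] the sum is the length of the iterated
    word. *)
Lemma iter_subst_opE (R : realType) (B : compactHausdorffType)
    (sigma : substitution B) (f : cfun R B) n b :
  iter n (subst_op sigma) f b = \sum_(c <- subst_iter sigma n b) f c.
Proof.
elim: n b => [|n IH] b; first by rewrite /= big_seq1.
rewrite iterS -[in RHS]addn1 subst_iterD subst_iter1 big_flatten big_map.
by apply: eq_bigr => c _; rewrite -IH.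
Qed.

(** * Words inside a concatenation of good blocks *)

Section QuasiAdditiveInfix.
Variables (R : realType) (T : eqType) (D : seq T -> R) (C K e : R) (L : nat).
Hypothesis e0 : 0 <= e.
Hypothesis D_quasi : forall u v, `|D (u ++ v) - D u - D v| <= C.
Hypothesis D_short : forall w, (size w <= L)%N -> `|D w| <= K.

Let D_cat u v : `|D (u ++ v)| <= `|D u| + `|D v| + C.
Proof.
rewrite (_ : D (u ++ v) = D u + D v + (D (u ++ v) - D u - D v)); last by ring.
by rewrite (le_trans (ler_normD _ _))// lerD// ler_normD.
Qed.

(** Levi's lemma. *)
Let cat_split (w W p v : seq T) : w ++ W = p ++ v -> (size w <= size p)%N ->
  exists2 p', p = w ++ p' & W = p' ++ v.
Proof.
elim: w p => [|x w IH] [|y p] //=; first by move=> ->; exists [::].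
  by move=> ->; exists (y :: p).
by move=> [-> /IH h] /h[p' -> ->]; exists p'.
Qed.

Let D_short_e w (n : nat) : (size w <= L)%N -> `|D w| <= e * n%:R + K.
Proof.
by move=> /D_short Dw; rewrite (le_trans Dw)// lerDr mulr_ge0.
Qed.

(** A whole block [w] costs [|D w| + C], where [C] pays for the concatenation, and this is covered
    by [e * size w]. Only the last, incomplete block is charged to [K]. *)
Let prefix_bound ws u v :
  (forall w, w \in ws -> (size w <= L)%N /\ `|D w| + C <= e * (size w)%:R) ->
  flatten ws = u ++ v -> `|D u| <= e * (size u)%:R + K.
Proof.
elim: ws u => [|w ws IH] u wsP /=.
  by case: u => // _; exact: D_short_e.
have [wL wD] := wsP w (mem_head _ _).
move=> E; have [uw|wu] := leqP (size u) (size w).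
  by apply: D_short_e; exact: leq_trans wL.
have [u' -> E'] := cat_split E (ltnW wu).
apply: le_trans (D_cat _ _) _; rewrite size_cat natrD mulrDr.
have wsP' x (xws : x \in ws) := wsP x (@mem_behead _ (w :: ws) x xws).
have := IH u' wsP' E'; lra.
Qed.

(** The word [u] begins with the end [s] of a block and goes on with a prefix of the remaining
    blocks. The two cut blocks cost [K] each and gluing [s] to the rest costs [C]; a [u] inside a
    single block costs [K]. *)
Lemma quasi_additive_infix ws p u q :
  (forall w, w \in ws -> (size w <= L)%N /\ `|D w| + C <= e * (size w)%:R) ->
  flatten ws = p ++ u ++ q -> `|D u| <= e * (size u)%:R + (2 * K + C).
Proof.
have K0 : 0 <= K by exact: le_trans (D_short (leq0n L : (size [::] <= L)%N)).
have C0 : 0 <= C by exact: le_trans (D_quasi [::] [::]).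
have DK w n : (size w <= L)%N -> `|D w| <= e * n%:R + (2 * K + C).
  by move=> /(D_short_e n) h; apply: le_trans h _; rewrite lerD2l; lra.
elim: ws p => [|w ws IH] p wsP /=.
  by case: p => //; case: u => // _; exact: DK.
have [wL wD] := wsP w (mem_head _ _).
have wsP' x (xws : x \in ws) := wsP x (@mem_behead _ (w :: ws) x xws).
move=> E; have [wp|pw] := leqP (size w) (size p).
  by have [p' _ /(IH _ wsP')] := cat_split E wp.
have [s sE /esym E'] := cat_split (esym E) (ltnW pw).
have sL : (size s <= L)%N.
  by apply: leq_trans wL; rewrite sE size_cat leq_addl.
have [us|su] := leqP (size u) (size s); first by apply: DK; exact: leq_trans sL.
have [u' -> E''] := cat_split E' (ltnW su).
apply: le_trans (D_cat _ _) _; rewrite size_cat natrD mulrDr.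
have := prefix_bound wsP' E''; have := D_short sL.
have : 0 <= e * (size s)%:R by rewrite mulr_ge0.
lra.
Qed.

End QuasiAdditiveInfix.

(** * The Banach space C(A) and Neumann series *)

Section ContinuousFunctionSpace.
Variables (R : realType) (A : compactHausdorffType).
Implicit Types (f g : cfun R A) (a : A).

Lemma cfunDE f g a : (f + g) a = f a + g a. Proof. by []. Qed.
Lemma cfunNE f a : (- f) a = - f a. Proof. by []. Qed.
Lemma cfunBE f g a : (f - g) a = f a - g a. Proof. by []. Qed.
Lemma cfunZE (c : R) f a : (c *: f) a = c * f a. Proof. by []. Qed.
Lemma cfun_sumE (I : Type) (r : seq I) (P : pred I) (F : I -> cfun R A) a :
  (\sum_(i <- r | P i) F i) a = \sum_(i <- r | P i) F i a.
Proof. exact: (big_morph (fun f => f a)). Qed.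

Lemma le_cfun_norm f a : `|f a| <= `|f|.
Proof. exact: le_sup_norm. Qed.

Lemma cfun_norm_le f c : 0 <= c -> (forall a, `|f a| <= c) -> `|f| <= c.
Proof. exact: sup_norm_le. Qed.

Lemma cfun_eval_cvg (T : Type) (F : set_system T) (u : T -> cfun R A) f a :
  Filter F -> u @ F --> f -> (fun t => u t a) @ F --> f a.
Proof.
move=> FF /cvgrPdist_le uf; apply/cvgrPdist_le => e e0.
move: (uf e e0); apply: filterS => t; apply: le_trans.
by rewrite -cfunBE le_cfun_norm.
Qed.

Lemma cst_is_cfun (c : R) : (fun=> c) \in @is_cfun R A.
Proof. by apply/mem_set => a; exact: cvg_cst. Qed.

Definition cfun_cst (c : R) : cfun R A := CFun (cst_is_cfun c).

(** The limit is taken pointwise. A Cauchy filter contains small balls around suitable [g], so the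
    limit is uniformly close to such a [g]; this gives its continuity by an [e / 3] argument, and
    then convergence in norm. *)
Lemma cfun_complete (F : set_system (cfun R A)) :
  ProperFilter F -> cauchy F -> cvg F.
Proof.
move=> FF /cauchyP Fc.
have Fa a : cvg ((fun f => f a) @ F).
  apply: cauchy_cvg; apply/cauchyP => e e0.
  have [g Fg] := Fc e e0; exists (g a).
  apply: (@filterS _ F _ (ball g e) _ _ Fg) => f /=.
  rewrite -!ball_normE /= => fg.
  by apply: le_lt_trans fg; exact: (le_cfun_norm (g - f)).
pose l a := lim ((fun f => f a) @ F).
have Fl e : 0 < e -> exists2 g : cfun R A, F (ball g e) & forall a, `|l a - g a| <= e.
  move=> e0; have [g Fg] := Fc e e0; exists g => // a.
  have gl : (fun f => `|f a - g a|) @ F --> `|l a - g a|.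
    by apply: cvg_norm; apply: cvgB; [exact: Fa|exact: cvg_cst].
  rewrite -(cvg_lim _ gl)//; apply: limr_le; first by apply/cvg_ex; eexists; exact: gl.
  apply: filterS Fg => f; rewrite -ball_normE /= => fg.
  apply: le_trans (ltW fg); rewrite [leRHS]distrC; exact: (le_cfun_norm (f - g)) .
have lc : l \in @is_cfun R A.
  apply/mem_set => a; apply/cvgrPdist_le => e e0.
  have [g _ gl] := Fl (e / 3) (divr_gt0 e0 (ltr0Sn _ _)).
  have /cvgrPdist_le /(_ (e / 3)) := @cfun_continuous _ _ g a.
  move=> /(_ (divr_gt0 e0 (ltr0Sn _ _))); apply: filterS => x gax.
  have := gl a; have := gl x; rewrite [`|l x - _|]distrC => h1 h2.
  rewrite (_ : l a - l x = (l a - g a) + (g a - g x) + (g x - l x)); last by ring.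
  rewrite (_ : e = e / 3 + e / 3 + e / 3); last by field.
  by apply: le_trans (ler_normD _ _) _; rewrite lerD// (le_trans (ler_normD _ _))// lerD.
apply/cvg_ex; exists (CFun lc); apply/cvg_ballP => e e0.
have [g Fg gl] := Fl (e / 2) (divr_gt0 e0 (ltr0Sn _ _)).
apply: filterS Fg => f; rewrite -!ball_normE /= => gf.
rewrite (splitr e) -[CFun lc](subrK g) -addrA; apply: le_lt_trans (ler_normD _ _) _.
rewrite ler_ltD//; apply: cfun_norm_le => [|a]; last exact: gl.
by rewrite divr_ge0 // ltW.
Qed.

End ContinuousFunctionSpace.

HB.instance Definition _ (R : realType) (A : compactHausdorffType) :=
  Uniform_isComplete.Build (cfun R A) (@cfun_complete R A).


Lemma lipschitz_continuous (R : realType) (V1 V2 : normedModType R)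
    (f : V1 -> V2) (k : R) :
  (forall u v, `|f u - f v| <= k * `|u - v|) -> continuous f.
Proof.
move=> fk u; apply/cvgrPdist_le => e e0.
have k1 : 0 < `|k| + 1 by rewrite ltr_wpDl.
have : \forall v \near u, `|u - v| <= e / (`|k| + 1).
  by move: (@cvg_id _ (nbhs u)) => /cvgrPdist_le; apply; rewrite divr_gt0.
apply: filterS => v uv; apply: le_trans (fk u v) _.
apply: le_trans (_ : (`|k| + 1) * `|u - v| <= _).
  by rewrite ler_wpM2r// (le_trans (ler_norm k))// lerDl.
by rewrite mulrC -ler_pdivlMr.
Qed.

Lemma iter_linear (R : realType) (W : lmodType R) (P : {linear W -> W}) n :
  linear (iter n P).
Proof. by elim: n => // n IH c u v; rewrite iterS IH linearP. Qed.

Section Neumann.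
Variables (R : realType) (W : normedModType R) (P : {linear W -> W}).
Variables (C theta : R).
Hypotheses (theta0 : 0 <= theta) (theta1 : theta < 1).
(** Completeness enters in this form, which can be checked coordinatewise on the complexified
    space. *)
Hypothesis geo_cvg : forall (u : nat -> W) (D : R),
  (forall n, `|u n| <= D * theta ^+ n) -> cvgn (series u).
Hypothesis P_bound : forall n u, `|iter n P u| <= C * theta ^+ n * `|u|.

Let PnB n u v : iter n P (u - v) = iter n P u - iter n P v.
Proof. by rewrite -scaleN1r addrC iter_linear addrC scaleN1r. Qed.

Let cvg_s u : cvgn (series (fun n => iter n P u)).
Proof.
by apply: (@geo_cvg _ (C * `|u|)) => n; rewrite mulrAC; exact: P_bound.
Qed.

Let P_continuous : continuous P.
Proof.
apply: (@lipschitz_continuous _ _ _ _ (C * theta)) => u v.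
by rewrite -linearB; have := P_bound 1 (u - v); rewrite expr1.
Qed.

Let Pn_cvg0 u : iter n P u @[n --> \oo] --> 0.
Proof. exact: (cvg_series_cvg_0 (@cvg_s u)). Qed.

Let G u := limn (series (fun n => iter n P u)).

Let G_bound u : `|G u| <= C / (1 - theta) * `|u|.
Proof.
have C0 : 0 <= C * `|u|.
  by have := P_bound 0 u; rewrite expr0 mulr1; apply: le_trans.
have gl : `|series (fun n => iter n P u) n| @[n --> \oo] --> `|G u|.
  by apply: cvg_norm; exact: cvg_s.
rewrite -(cvg_lim _ gl)//; apply: limr_le; first by apply/cvg_ex; eexists; exact: gl.
apply: nearW => n; rewrite /series /=.
apply: le_trans (ler_norm_sum _ _ _) _.
apply: le_trans (_ : \sum_(0 <= i < n) (C * `|u|) * theta ^+ i <= _).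
  by apply: ler_sum => i _; rewrite mulrAC; exact: P_bound.
rewrite -[leLHS]/(series (geometric (C * `|u|) theta) n).
rewrite geometric_seriesE ?lt_eqF//= [leRHS]mulrAC.
by rewrite ler_pM2r ?invr_gt0 ?subr_gt0// ler_piMr// gerBl exprn_ge0.
Qed.

(** The inverse is the sum of the series of [iter n P u]: one identity comes from shifting the index
    under the continuous [P], the other from telescoping, as [iter n P u] tends to 0. *)
Lemma neumann : exists G : W -> W,
  [/\ continuous G, cancel G (fun u => u - P u) & cancel (fun u => u - P u) G].
Proof.
exists G; split.
- apply: (@lipschitz_continuous _ _ _ _ (C / (1 - theta))) => u v.
  suff -> : G u - G v = G (u - v) by exact: G_bound.
  rewrite /G -limB ?cvg_s//; congr (limn _); apply/funext => n.
  rewrite -[LHS]/(\sum_(0 <= k < n) iter k P u - \sum_(0 <= k < n) iter k P v).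
  by rewrite -sumrB; apply: eq_bigr => i _; rewrite PnB.
- move=> u; apply/eqP; rewrite subr_eq addrC; apply/eqP.
  apply: cvg_lim => //.
  rewrite -cvg_shiftS.
  rewrite (_ : [sequence _]_n = fun n => P (series (fun n => iter n P u) n) + u).
    apply: cvgD; last exact: cvg_cst.
    by apply: continuous_cvg; [exact: P_continuous|exact: cvg_s].
  apply/funext => n; rewrite /series /= big_nat_recl//= addrC linear_sum.
  by congr (_ + _); apply: eq_bigr.
- move=> u; apply: cvg_lim => //.
  rewrite (_ : series _ = fun n => u - iter n P u).
    by rewrite -[X in _ --> X]subr0; apply: cvgB; [exact: cvg_cst|exact: Pn_cvg0].
  apply/funext => n; rewrite /series /=.
  rewrite (eq_bigr (fun i => - (iter i.+1 P u - iter i P u))).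
    by rewrite sumrN telescope_sumr// opprB.
  by move=> i _; rewrite PnB opprB -iterSr.
Qed.
End Neumann.

Lemma neumann_linear (R : realType) (W : normedModType R) (P : W -> W)
    (C theta : R) : linear P -> 0 <= theta -> theta < 1 ->
  (forall (u : nat -> W) (D : R),
    (forall n, `|u n| <= D * theta ^+ n) -> cvgn (series u)) ->
  (forall n u, `|iter n P u| <= C * theta ^+ n * `|u|) ->
  exists G : W -> W,
  [/\ continuous G, cancel G (fun u => u - P u) & cancel (fun u => u - P u) G].
Proof.
move=> lP t0 t1 gc Pb.
pose PL : {linear W -> W} := HB.pack P (GRing.isLinear.Build _ _ _ _ P lP).
exact: (@neumann R W PL C theta).
Qed.

(** * Complex scalars on the complexified space *)

Section ComplexScale.
Variables (R : realType) (V : normedModType R).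
Implicit Types (z c : complex R) (u v : V * V) (x : R).

Lemma normc_geRe z : `|complex.Re z| <= Normc.normc z.
Proof.
by case: z => a b /=; rewrite -sqrtr_sqr ler_sqrt ?addr_ge0 ?sqr_ge0// lerDl sqr_ge0.
Qed.

Lemma normc_geIm z : `|complex.Im z| <= Normc.normc z.
Proof.
by case: z => a b /=; rewrite -sqrtr_sqr ler_sqrt ?addr_ge0 ?sqr_ge0// lerDr sqr_ge0.
Qed.

Lemma normcX z n : Normc.normc (z ^+ n) = Normc.normc z ^+ n.
Proof.
elim: n => [|n IH]; first by rewrite !expr0 Normc.normc1.
by rewrite !exprS Normc.normcM IH.
Qed.

Lemma normcR x : Normc.normc (x%:C)%C = `|x|.
Proof. by rewrite /= expr0n addr0 sqrtr_sqr. Qed.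

Lemma complex_scale_linear z : linear (complex_scale z : V * V -> V * V).
Proof.
case: z => a b c [u1 u2] [v1 v2]; rewrite /complex_scale /=.
rewrite !scalerDr !scalerA ![a * c]mulrC ![b * c]mulrC -!scalerA.
congr (_, _) => /=; rewrite ?scalerBr ?scalerDr ?opprD.
  by rewrite addrACA.
by rewrite addrACA.
Qed.

Lemma complex_scaleM z c u :
  complex_scale (z * c) u = complex_scale z (complex_scale c u).
Proof.
case: z c u => [a b] [c d] [u1 u2]; rewrite /complex_scale /=; congr (_, _).
  by rewrite scalerBl scalerDl scalerBr scalerDr !scalerA !opprD addrACA.
rewrite scalerBl scalerDl scalerBr scalerDr !scalerA.
by rewrite [X in X + _]addrC [X in _ + X]addrC addrACA.
Qed.

Lemma complex_scale1 u : complex_scale 1 u = u.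
Proof.
by case: u => u1 u2; rewrite /complex_scale /= !scale1r !scale0r subr0 add0r.
Qed.

(** The product carries the maximum norm, and each coordinate has two terms: hence the factor 2. *)
Lemma complex_scale_norm z u : `|complex_scale z u| <= 2 * Normc.normc z * `|u|.
Proof.
have h (a b : R) (v w : V) : `|a| <= Normc.normc z -> `|b| <= Normc.normc z ->
    `|v| <= `|u| -> `|w| <= `|u| ->
    `|a *: v + b *: w| <= 2 * Normc.normc z * `|u|.
  move=> ha hb hv hw; apply: le_trans (ler_normD _ _) _.
  by rewrite !normrZ -mulrA mulr_natl mulr2n lerD// ler_pM.
have h1 : `|u.1| <= `|u| by rewrite [leRHS]prod_normE le_max lexx.
have h2 : `|u.2| <= `|u| by rewrite [leRHS]prod_normE le_max lexx orbT.
rewrite [leLHS]prod_normE ge_max /complex_scale /= -scaleNr.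
by rewrite !h ?normrN ?normc_geRe ?normc_geIm.
Qed.

Lemma complex_scale_continuous z : continuous (complex_scale z : V * V -> V * V).
Proof.
apply: (@lipschitz_continuous _ _ _ _ (2 * Normc.normc z)) => u v.
suff -> : complex_scale z u - complex_scale z v = complex_scale z (u - v).
  exact: complex_scale_norm.
by rewrite -scaleN1r addrC -complex_scale_linear scaleN1r addrC.
Qed.

Lemma complex_extension_scale (M : {linear V -> V}) z u :
  complex_extension M (complex_scale z u) =
  complex_scale z (complex_extension M u).
Proof.
by rewrite /complex_extension /complex_scale /= linearB linearD !linearZ.
Qed.

End ComplexScale.

(** * Spectral radius of positive operators on C(A) *)

(** Bernoulli's inequality at [x = 1 / (2n)]. A rate can thus be lowered by the factor [1 - x] at
    the cost of at most a factor 2 in its n-th power. *)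
Lemma bernoulli_half (R : realType) (n : nat) : (0 < n)%N ->
  2^-1 <= (1 - (2 * n%:R)^-1) ^+ n :> R.
Proof.
move=> n0; have bern (x : R) k : 0 <= x <= 1 -> 1 - k%:R * x <= (1 - x) ^+ k.
  move=> /andP[x0 x1]; elim: k => [|k IH]; first by rewrite mul0r subr0.
  rewrite exprS; apply: le_trans (_ : (1 - x) * (1 - k%:R * x) <= _).
    rewrite -natr1; have : 0 <= k%:R * x ^+ 2 by rewrite mulr_ge0 ?sqr_ge0.
    by nra.
  by rewrite ler_wpM2l// subr_ge0.
have nR : 1 <= n%:R :> R by rewrite ler1n.
have := bern (2 * n%:R)^-1 n.
rewrite (_ : 1 - _ * _ = 2^-1); last by field; lra.
by apply; rewrite invr_ge0 mulr_ge0//= invf_le1; nra.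
Qed.

Lemma geometric_series_cfun_cvg (R : realType) (A : compactHausdorffType)
    (theta : R) (u : nat -> cfun R A) (D : R) :
  0 <= theta -> theta < 1 ->
  (forall n, `|u n| <= D * theta ^+ n) -> cvgn (series u).
Proof.
move=> t0 t1 uD; apply: normed_cvg.
apply: (@series_le_cvg _ _ (geometric D theta)).
- by move=> n; exact: normr_ge0.
- by move=> n; apply: le_trans (uD n).
- exact: uD.
- by apply: is_cvg_geometric_series; rewrite ger0_norm.
Qed.

Lemma geometric_series_cfun2_cvg (R : realType) (A : compactHausdorffType)
    (theta : R) (u : nat -> ((cfun R A * cfun R A)%type : normedModType R)) (D : R) :
  0 <= theta -> theta < 1 ->
  (forall n, `|u n| <= D * theta ^+ n) -> cvgn (series u).
Proof.
move=> t0 t1 uD.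
have u1 n : `|(u n).1| <= D * theta ^+ n.
  by apply: le_trans (uD n); rewrite [leRHS]prod_normE le_max lexx.
have u2 n : `|(u n).2| <= D * theta ^+ n.
  by apply: le_trans (uD n); rewrite [leRHS]prod_normE le_max lexx orbT.
have c1 := geometric_series_cfun_cvg t0 t1 u1.
have c2 := geometric_series_cfun_cvg t0 t1 u2.
rewrite (_ : series u = fun n => (series (fst \o u) n, series (snd \o u) n)).
  apply/cvg_ex; exists (limn (series (fst \o u)), limn (series (snd \o u))).
  apply: (@cvg_pair _ _ _ \oo (nbhs (limn (series (fst \o u))))
    (nbhs (limn (series (snd \o u))))); [exact: c1|exact: c2].
apply/funext => n; rewrite /series /=.
elim: n => [|n IH]; first by rewrite !big_geq.
by rewrite !big_nat_recr//= IH.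
Qed.

Section PositiveOperator.
Variables (R : realType) (A : compactHausdorffType).
Variable M : {linear cfun R A -> cfun R A}.
Hypothesis M_pos : forall f : cfun R A, (forall a, 0 <= f a) -> forall a, 0 <= M f a.
Implicit Types (f g : cfun R A) (a : A) (q K l s : R).
Let one : cfun R A := cfun_cst A 1.

Lemma le_iter_pos n f g : (forall a, f a <= g a) ->
  forall a, iter n M f a <= iter n M g a.
Proof.
move=> fg a; rewrite -subr_ge0 -cfunBE.
have -> : iter n M g - iter n M f = iter n M (g - f).
  by rewrite -scaleN1r addrC -iter_linear scaleN1r addrC.
elim: n a => [|n IH] a; last exact: M_pos.
by rewrite cfunBE subr_ge0.
Qed.

Lemma iter_pos_linearZ n (c : R) f : iter n M (c *: f) = c *: iter n M f.
Proof. by elim: n => //= n ->; rewrite linearZ. Qed.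

Lemma iter_pos_ge0 n f : (forall a, 0 <= f a) -> forall a, 0 <= iter n M f a.
Proof. by move=> f0; elim: n => // n IH a; exact: M_pos. Qed.

(** Positivity applied to [-|f| <= f <= |f|]. It reduces norm estimates on powers of [M] to the
    function 1. *)
Lemma normr_iter_pos n f a : `|iter n M f a| <= `|f| * iter n M one a.
Proof.
rewrite -cfunZE -iter_pos_linearZ ler_norml; apply/andP; split.
  rewrite -cfunNE -scaleN1r -iter_pos_linearZ scaleN1r -scaleNr.
  apply: le_iter_pos => b; rewrite cfunZE mulr1 lerNl -[leLHS]cfunNE.
  by rewrite -[`|f|]normrN (le_trans (ler_norm _))// le_cfun_norm.
apply: le_iter_pos => b; rewrite cfunZE mulr1.
by rewrite (le_trans (ler_norm _))// le_cfun_norm.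
Qed.

Definition growth_bound (q K : R) := forall n a, iter n M one a <= K * q ^+ n.

Lemma growth_bound_norm q K n f : 0 <= q -> growth_bound q K ->
  `|iter n M f| <= `|K| * q ^+ n * `|f|.
Proof.
move=> q0 qK; apply: cfun_norm_le; first by rewrite !mulr_ge0 ?exprn_ge0.
move=> a; apply: le_trans (normr_iter_pos n f a) _; rewrite mulrC.
by rewrite ler_wpM2r// (le_trans (qK n a))// ler_wpM2r ?exprn_ge0 ?ler_norm.
Qed.

(* The weight [w] is chosen so that M w <= q' w and 1 <= w. *)
Lemma growth_bound_improve q n : 0 < q -> (0 < n)%N ->
  (forall a, iter n M one a <= q ^+ n / 2) ->
  exists q' K, [/\ 0 < q', q' < q & growth_bound q' K].
Proof.
move=> q0 n0 Mq.
have nR : 1 <= n%:R :> R by rewrite ler1n.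
(* The hypothesis has a factor 1/2 to spare at the power [n]; spread over [n] steps, it lowers the
   rate from [q] to [q * t]. *)
pose t : R := 1 - (2 * n%:R)^-1.
have t0 : 0 < t.
  by rewrite subr_gt0 invf_lt1; nra.
have t1 : t < 1 by rewrite gtrBl invr_gt0; nra.
pose q' := q * t; have q'0 : 0 < q' by rewrite mulr_gt0.
have q'n : q ^+ n / 2 <= q' ^+ n.
  by rewrite exprMn ler_wpM2l ?exprn_ge0 ?(ltW q0)//; exact: bernoulli_half.
pose W k : cfun R A := q' ^- k *: iter k M one.
pose w := \sum_(k < n) W k.
have W0 k a : 0 <= W k a.
  rewrite cfunZE; apply: mulr_ge0; first by rewrite invr_ge0 exprn_ge0// ltW.
  by apply: iter_pos_ge0 => b; exact: ler01.
have w1 a : 1 <= w a.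
  rewrite /w cfun_sumE -(prednK n0) big_ord_recl.
  rewrite {1}/W expr0 invr1 scale1r /= lerDl.
  by apply: sumr_ge0 => i _; exact: W0.
have MW k : M (W k) = q' *: W k.+1.
  by rewrite linearZ /= scalerA exprS invfM mulrA divff ?mul1r ?gt_eqF.
have Mw a : M w a <= q' * w a.
  rewrite /w linear_sum.
  rewrite (eq_bigr (fun k : 'I_n => q' *: W k.+1) (fun k _ => MW k)) -scaler_sumr cfunZE.
  rewrite ler_wpM2l ?(ltW q'0)//.
  (* Up to the factor [q'], applying [M] to [w] shifts the index: the sum loses [W 0 = 1] and gains
     [W n], which is at most 1 by the choice of [q']. *)
  have /(congr1 (fun f : cfun R A => f a)) :
      W 0%N + \sum_(i < n) W i.+1 = \sum_(i < n) W i + W n.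
    by rewrite -(big_ord_recl n W) big_ord_recr.
  rewrite !cfunDE => e.
  have Wn : W n a <= 1.
    rewrite cfunZE mulrC ler_pdivrMr ?exprn_gt0// mul1r.
    exact: le_trans (Mq a) q'n.
  have W1 : W 0%N a = 1 by rewrite /W expr0 invr1 scale1r.
  rewrite W1 in e; rewrite /w; move: e Wn.
  set x := (\sum_(i < n) W i) a; set y := (\sum_(i < n) W i.+1) a.
  by lra.
exists q', `|w|; split=> //; first by rewrite gtr_pMr.
move=> k a; apply: le_trans (_ : iter k M w a <= _); first exact: le_iter_pos.
elim: k a => [|k IH] a.
  by rewrite expr0 mulr1 (le_trans (ler_norm _))// le_cfun_norm.
rewrite iterSr; apply: le_trans (_ : iter k M (q' *: w) a <= _).
  by apply: le_iter_pos => b; rewrite cfunZE.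
by rewrite iter_pos_linearZ cfunZE exprS mulrCA ler_wpM2l// ltW.
Qed.

(** Write [z - M = z (1 - z^-1 M)]. The powers of [z^-1 M] decay like [(q / |z|)^n], so a Neumann
    series inverts the second factor. *)
Lemma growth_bound_resolvent q K z : 0 <= q -> growth_bound q K ->
  q < Normc.normc z -> resolvent_set M z.
Proof.
move=> q0 qK qz; set c := Normc.normc z.
have c0 : 0 < c by exact: le_lt_trans q0 qz.
have z0 : z != 0 by apply/eqP => z0; move: c0; rewrite /c z0 Normc.normc0 ltxx.
pose V : normedModType R := (cfun R A * cfun R A)%type.
pose P (u : V) : V := complex_scale z^-1 (complex_extension M u).
have Plin : linear P.
  move=> k u v; rewrite /P -complex_scale_linear; congr complex_scale.
  by rewrite /complex_extension /= !linearP.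
have PnE n u : iter n P u =
    complex_scale (z^-1 ^+ n) (iter n M u.1, iter n M u.2).
  elim: n => [|n IH]; first by rewrite expr0 complex_scale1; case: u.
  by rewrite iterS IH /P complex_extension_scale -complex_scaleM -exprS.
have Pn n u : `|iter n P u| <= (2 * `|K|) * (q / c) ^+ n * `|u|.
  rewrite PnE; apply: le_trans (complex_scale_norm _ _) _.
  rewrite normcX Normc.normcV -/c exprMn.
  have -> : 2 * `|K| * (q ^+ n * c^-1 ^+ n) * `|u| =
    2 * c^-1 ^+ n * (`|K| * q ^+ n * `|u|) by ring.
  rewrite ler_wpM2l ?mulr_ge0 ?exprn_ge0 ?invr_ge0 ?(ltW c0)//.
  have u1 : `|u.1| <= `|u| by rewrite [leRHS]prod_normE le_max lexx.
  have u2 : `|u.2| <= `|u| by rewrite [leRHS]prod_normE le_max lexx orbT.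
  rewrite [leLHS]prod_normE ge_max /=.
  have Kq : 0 <= `|K| * q ^+ n by rewrite mulr_ge0 ?exprn_ge0.
  apply/andP; split; apply: le_trans (growth_bound_norm _ _ q0 qK) _;
    exact: ler_wpM2l.
have t1 : q / c < 1 by rewrite ltr_pdivrMr// mul1r.
have t0 : 0 <= q / c by rewrite divr_ge0// ltW.
have [G [Gc GK KG]] := neumann_linear Plin t0 t1
  (fun u D => geometric_series_cfun2_cvg t0 t1) Pn.
have E u : complex_scale z u - complex_extension M u =
    complex_scale z (u - P u).
  have lB (x y : V) : complex_scale z (x - y) = complex_scale z x - complex_scale z y.
    by rewrite -scaleN1r addrC complex_scale_linear scaleN1r addrC.
  by rewrite lB /P -complex_scaleM divff// complex_scale1.
exists (fun u => G (complex_scale z^-1 u)); split.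
- move=> u; apply: continuous_comp; last exact: Gc.
  exact: complex_scale_continuous.
- move=> u /=; rewrite E GK -complex_scaleM divff// complex_scale1//.
- move=> u /=; rewrite E -complex_scaleM mulVf// complex_scale1 KG//.
Qed.

(* Only boundedness below of q - M is extracted from the resolvent. *)
Lemma resolvent_bounded_below q : resolvent_set M (q%:C)%C ->
  exists2 s : R, 0 < s & forall f, `|f| <= s * `|q *: f - M f|.
Proof.
move=> [S [Sc _ SK]].
have SE f : S (q *: f - M f, 0) = (f, 0).
  rewrite (_ : (_, _) = (q *: f - 0 *: 0 - M f, 0 *: f + q *: 0 - M 0)).
    exact: (SK (f, 0)).
  by rewrite !scale0r scaler0 linear0 !subr0 addr0.
have S0 : S (0, 0) = (0, 0) by have := SE 0; rewrite scaler0 linear0 subr0.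
have /cvgrPdist_le /(_ 1 ltr01) := Sc (0, 0).
rewrite S0 => /nbhs_ballP [d /= d0 dS].
exists (2 / d); first by rewrite divr_gt0.
move=> f; have [L0|L0] := eqVneq (q *: f - M f) 0.
  by have := SE f; rewrite L0 S0 => -[<-]; rewrite normr0 mulr0.
set g := q *: f - M f in L0 *.
have g0 : 0 < `|g| by rewrite normr_gt0.
(* This [c] scales [g] to norm [d / 2], inside the ball where continuity at 0 bounds [S] by 1.
   Homogeneity comes from [SE] applied to [c *: f]. *)
pose c := d / 2 / `|g|.
have c0 : 0 < c by rewrite !divr_gt0.
have /dS : ball (0 : cfun R A, 0 : cfun R A) d (c *: g, 0 : cfun R A).
  split => /=; rewrite -ball_normE /= sub0r normrN ?normr0//.
  rewrite normrZ gtr0_norm// divfK ?gt_eqF//.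
  by rewrite ltr_pdivrMr// ltr_pMr// ltr1n.
have -> : c *: g = q *: (c *: f) - M (c *: f).
  by rewrite [M (c *: f)]linearZ /= /g scalerBr !scalerA [c * q]mulrC.
rewrite SE /= => h.
have : `|c *: f| <= 1.
  apply: le_trans h; rewrite [leRHS]prod_normE le_max /=.
  by rewrite sub0r normrN lexx.
rewrite normrZ gtr0_norm// -ler_pdivlMl// mulr1 => /le_trans; apply.
by rewrite /c !invfM !invrK [d^-1 * 2]mulrC.
Qed.

(** * The infimum of the growth rates lies in the spectrum *)

Section SpectralRadius.
Hypothesis M1 : forall a, 1 <= M one a.
Variable a0 : A.

Let iter_one_ge1 n a : 1 <= iter n M one a.
Proof.
elim: n a => [|n IH] a; first exact: lexx.
apply: le_trans (M1 a) _.
by apply: (@le_iter_pos 1) => b; exact: IH.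
Qed.

Let growth : set R := [set q | 0 < q /\ exists K, growth_bound q K].

(** A rate [q < 1] would force [M^n 1] to 0. *)
Let growth_ge1 q : growth q -> 1 <= q.
Proof.
move=> [q0 [K qK]]; rewrite leNgt; apply/negP => q1.
have : (fun n => K * q ^+ n) @ \oo --> K * 0.
  by apply: cvgMr; apply: cvg_expr; rewrite ger0_norm ?ltW.
rewrite mulr0 => /cvgrPdist_lt /(_ 1 ltr01) [n _ /(_ n (leqnn n))] /=.
rewrite sub0r normrN => /(le_lt_trans (ler_norm _)).
by rewrite ltNge (le_trans (iter_one_ge1 n a0) (qK n a0)).
Qed.

Let growth_norm : growth (`|M one| + 1).
Proof.
have r0 : 0 < `|M one| + 1 by rewrite ltr_wpDl.
split=> //; exists 1 => n; elim: n => [|n IH] a.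
  by rewrite expr0 mulr1.
rewrite iterSr; apply: le_trans (_ : iter n M ((`|M one| + 1) *: one) a <= _).
  apply: le_iter_pos => b; rewrite cfunZE mulr1.
  by apply: le_trans (ler_norm _) _; rewrite (le_trans (le_cfun_norm _ _))// lerDl.
by rewrite iter_pos_linearZ cfunZE exprS mulrCA ler_wpM2l// ltW.
Qed.

Let has_inf_growth : has_inf growth.
Proof. by split; [exists (`|M one| + 1)|exists 1 => q; exact: growth_ge1]. Qed.

Let q0 := inf growth.

Let q0_ge1 : 1 <= q0.
Proof. by apply: lb_le_inf; [exact: has_inf_growth.1|move=> q; exact: growth_ge1]. Qed.

(** Partial sum of the Neumann series of [(l - M)^-1] at the function 1. *)
Let partial_resolvent (l : R) (n : nat) : cfun R A :=
  \sum_(k < n) l ^- k.+1 *: iter k M one.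

Let partial_resolventE l n : 0 < l ->
  l *: partial_resolvent l n - M (partial_resolvent l n) =
  one - l ^- n *: iter n M one.
Proof.
move=> l0; elim: n => [|n IH].
  by rewrite /partial_resolvent big_ord0 scaler0 linear0 expr0 invr1 scale1r !subrr.
rewrite /partial_resolvent big_ord_recr -/(partial_resolvent l n) /=.
rewrite scalerDr linearD opprD addrACA IH [M (_ *: iter _ _ _)]linearZ /= scalerA.
by rewrite {1}exprS invfM mulrA divff ?gt_eqF// mul1r addrA subrK.
Qed.

(* If q0 were in the resolvent set, then the Neumann sums at a real l > q0
   would stay bounded as l decreases to q0. *)
Let partial_resolvent_bound s l : 0 < s ->
  (forall f, `|f| <= s * `|q0 *: f - M f|) ->
  q0 < l -> (l - q0) * s <= 2^-1 ->
  forall n a, partial_resolvent l n a <= 4 * s.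
Proof.
move=> s0 sP ql ls.
have l0 : 0 < l by rewrite (lt_trans _ ql)// (lt_le_trans ltr01).
(* Some growth rate [q] lies below [l], so [l^-n M^n 1] tends to 0 and has norm at most 1 from some
   [N] on. *)
have [q [qg [K qK]] ql'] : exists2 q, growth q & q < l.
  exact: (inf_lt has_inf_growth.1).
have Kl : (fun n => `|K| * (q / l) ^+ n) @ \oo --> `|K| * 0.
  apply: cvgMr; apply: cvg_expr; rewrite ger0_norm ?divr_ge0 ?ltW//.
  by rewrite ltr_pdivrMr// mul1r.
rewrite mulr0 in Kl; move/cvgrPdist_lt : Kl => /(_ 1 ltr01) [N _ NP].
(* From [(l - M) g = 1 - l^-n M^n 1] and the boundedness below, [|g| <= s (2 + (l - q0) |g|) <= 2 s
   + |g| / 2]. *)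
have big n : (N <= n)%N -> `|partial_resolvent l n| <= 4 * s.
  move=> /NP /=; rewrite sub0r normrN => /(le_lt_trans (ler_norm _)) Kn.
  set g := partial_resolvent l n.
  have := sP g; rewrite (_ : q0 *: g - M g =
      one - l ^- n *: iter n M one - (l - q0) *: g); last first.
    by rewrite -partial_resolventE// scalerBl opprB [RHS]addrC addrA subrK.
  have : `|one - l ^- n *: iter n M one - (l - q0) *: g| <=
      2 + (l - q0) * `|g|.
    apply: le_trans (ler_normB _ _) _; rewrite lerD//; last first.
      by rewrite normrZ ger0_norm// subr_ge0 ltW.
    apply: le_trans (ler_normB _ _) _; rewrite [leRHS](natrD _ 1 1) lerD//.
      by apply: cfun_norm_le => // a; rewrite normr1.
    rewrite normrZ ger0_norm ?invr_ge0 ?exprn_ge0 ?(ltW l0)//.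
    apply: le_trans (ltW Kn); rewrite exprMn exprVn mulrC.
    rewrite mulrA ler_wpM2r ?invr_ge0 ?exprn_ge0 ?(ltW l0)//.
    apply: le_trans (growth_bound_norm _ _ (ltW qg) qK) _.
    rewrite ler_piMr ?mulr_ge0 ?exprn_ge0 ?(ltW qg)//.
    by apply: cfun_norm_le => // a; rewrite normr1.
  by nra.
(* The terms are nonnegative, so the sums increase with [n] and the bound for large [n] covers all
   [n]. *)
move=> n a; apply: le_trans (_ : partial_resolvent l (maxn N n) a <= _).
  rewrite /partial_resolvent !cfun_sumE -(subnKC (leq_maxr N n)).
  rewrite big_split_ord /= lerDl; apply: sumr_ge0 => k _.
  apply: (@mulr_ge0 R (l ^- (n + k).+1) (iter (n + k) M one a)).
    by rewrite invr_ge0 exprn_ge0// ltW.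
  by apply: iter_pos_ge0 => b; exact: ler01.
apply: le_trans (ler_norm _) _; apply: le_trans (le_cfun_norm _ _) _.
by apply: big; exact: leq_maxl.
Qed.

(** A finite sum at [q0] is compared with the one at [l = q0 / t], where [t = 1 - 1 / (2m)]: each
    term shrinks by a factor [t^(k+1) >= t^m >= 1/2], whence [8 * s] in place of [4 * s]. *)
Let bounded_at_q0 s : 0 < s -> (forall f, `|f| <= s * `|q0 *: f - M f|) ->
  forall n a, \sum_(k < n) q0 ^- k.+1 * iter k M one a <= 8 * s.
Proof.
move=> s0 sP n a; have q00 : 0 < q0 by exact: lt_le_trans ltr01 q0_ge1.
(* The first condition on [m] controls the powers of [t], the second gives [(l - q0) * s <= 1/2]. *)
have [m nm ms] : exists2 m, (n < m)%N & 2 * q0 * s + 1 <= 2 * m%:R.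
  exists (maxn n.+1 (Num.truncn (2 * q0 * s + 1)).+1); first exact: leq_maxl.
  apply: le_trans (_ : (Num.truncn (2 * q0 * s + 1)).+1%:R <= _).
    by rewrite ltW// truncnS_gt.
  apply: le_trans (_ : (maxn n.+1 (Num.truncn (2 * q0 * s + 1)).+1)%:R <= _).
    by rewrite ler_nat leq_maxr.
  by rewrite ler_peMl// ler1n.
have m0 : (0 < m)%N by exact: leq_ltn_trans nm.
have mR : 1 <= m%:R :> R by rewrite ler1n.
pose x : R := (2 * m%:R)^-1; pose t := 1 - x.
have x0 : 0 < x by rewrite invr_gt0; nra.
have xm : x * (2 * m%:R) = 1 by rewrite mulVf// gt_eqF//; nra.
have t0 : 0 < t by rewrite /t; nra.
have t1 : t < 1 by rewrite /t; lra.
have ql : q0 < q0 / t by rewrite ltr_pdivlMr// gtr_pMr.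
have ls : (q0 / t - q0) * s <= 2^-1.
  rewrite (_ : (q0 / t - q0) * s = q0 * s * x / t); last first.
    by rewrite /t; field; rewrite gt_eqF.
  by rewrite ler_pdivrMr// /t; nra.
have := partial_resolvent_bound s0 sP ql ls n a.
rewrite cfun_sumE => h.
rewrite (_ : 8 * s = 2 * (4 * s)); last by ring.
rewrite -ler_pdivrMl//; apply: le_trans h; rewrite mulr_sumr.
apply: ler_sum => k _; rewrite cfunZE mulrA ler_wpM2r//.
  by rewrite (le_trans ler01).
rewrite exprMn exprVn invfM invrK mulrC.
rewrite ler_wpM2l ?invr_ge0 ?exprn_ge0 ?(ltW q00)//.
apply: le_trans (bernoulli_half R m0) _; apply: ler_wiXn2l; rewrite ?(ltW t0) ?(ltW t1)//.
exact: leq_trans (ltn_ord k) (ltnW nm).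
Qed.

(** Otherwise [n M^n 1 <= B^2 q0^(n+2)] for all [n]. For large [n] the right side is at most
    [n q0^n / 2], and [growth_bound_improve] yields a growth rate below the infimum [q0]. *)
Let q0_spectrum : spectrum M (q0%:C)%C.
Proof.
move=> /resolvent_bounded_below[s s0 sP].
have q00 : 0 < q0 by exact: lt_le_trans ltr01 q0_ge1.
set B := 8 * s; have B0 : 0 < B by rewrite mulr_gt0.
have SB n a : \sum_(k < n) q0 ^- k.+1 * iter k M one a <= B.
  exact: bounded_at_q0.
have term_ge0 k a : 0 <= q0 ^- k.+1 * iter k M one a.
  by rewrite mulr_ge0 ?invr_ge0 ?exprn_ge0 ?(ltW q00)// (le_trans ler01).
have MB k a : iter k M one a <= B * q0 ^+ k.+1.
  rewrite -ler_pdivrMr ?exprn_gt0// mulrC; apply: le_trans (SB k.+1 a).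
  by rewrite big_ord_recr /= lerDr; apply: sumr_ge0.
(* Write [M^n 1 = M^k (M^(n-k) 1)] once for each [k < n]: [MB] bounds the inner function, and [SB]
   bounds the sum over [k] of what remains. *)
have nM n a : n%:R * iter n M one a <= B ^+ 2 * q0 ^+ n.+2.
  apply: le_trans (_ : \sum_(k < n) B * q0 ^+ n.+2 *
    (q0 ^- k.+1 * iter k M one a) <= _); last first.
    rewrite -mulr_sumr [leRHS](_ : _ = B * q0 ^+ n.+2 * B); last by ring.
    by rewrite ler_wpM2l// mulr_ge0 ?exprn_ge0 ?(ltW q00) ?(ltW B0).
  rewrite mulr_natl -[X in _ *+ X](card_ord n) -sumr_const; apply: ler_sum => k _.
  have kn : (k <= n)%N by exact/ltnW/ltn_ord.
  have -> : iter n M one = iter k M (iter (n - k) M one) by rewrite -iterD subnKC.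
  apply: le_trans (_ : iter k M ((B * q0 ^+ (n - k).+1) *: one) a <= _).
    by apply: le_iter_pos => b; rewrite cfunZE mulr1.
  rewrite iter_pos_linearZ cfunZE mulrA ler_wpM2r ?(le_trans ler01)//.
  rewrite -mulrA ler_wpM2l ?(ltW B0)//.
  by rewrite -expfB_cond ?gt_eqF//= ?subSS ?subSn// 1?ltnW// ltnW.
have [n n0 nB] : exists2 n, (0 < n)%N & 2 * B ^+ 2 * q0 ^+ 2 <= n%:R.
  by exists (Num.truncn (2 * B ^+ 2 * q0 ^+ 2)).+1; rewrite // ltW// truncnS_gt.
have [a|q [K [q0' qq K']]] := growth_bound_improve q00 n0.
  rewrite ler_pdivlMr// -(@ler_pM2l _ n%:R) ?ltr0n//.
  have h := nM n a; rewrite -[n.+2]addn2 [q0 ^+ _]exprD in h.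
  have qn : 0 <= q0 ^+ n by rewrite exprn_ge0// ltW.
  by have := ler_wpM2r qn nB; lra.
have : q0 <= q by apply: ge_inf; [exact: has_inf_growth.2|split=> //; exists K].
by rewrite leNgt qq.
Qed.

Let spectrum_ub q : growth q -> ubound [set Normc.normc z | z in spectrum M] q.
Proof.
move=> [q_gt0 [K qK]] _ [z zs <-]; rewrite leNgt; apply/negP => qz; apply: zs.
exact: growth_bound_resolvent (ltW q_gt0) qK qz.
Qed.

(** The spectrum contains [q0 >= 1], and [growth_norm] bounds it, so that [sup] is a true
    supremum. *)
Lemma spectral_radius_pos_ge1 : 1 <= spectral_radius M.
Proof.
apply: le_trans q0_ge1 _; rewrite -[leLHS]gtr0_norm; last first.
  exact: lt_le_trans ltr01 q0_ge1.
rewrite -normcR; apply: ub_le_sup; last by exists (q0%:C)%C.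
by exists (`|M one| + 1); exact: spectrum_ub growth_norm.
Qed.

(** Otherwise [growth_bound_improve] gives a growth rate below the spectral radius, while every
    growth rate bounds the spectrum. This keeps [T^n 1] away from 0. *)
Lemma spectral_radius_pos_lt n : (0 < n)%N ->
  exists a, spectral_radius M ^+ n / 2 < iter n M one a.
Proof.
move=> n0; apply: contrapT => /forallNP h.
have r0 : 0 < spectral_radius M.
  exact: lt_le_trans ltr01 spectral_radius_pos_ge1.
have [|q [K [q_gt0 qr qK]]] := growth_bound_improve r0 n0.
  by move=> a; rewrite leNgt; apply/negP/h.
suff : spectral_radius M <= q by rewrite leNgt qr.
apply: ge_sup; first by exists (Normc.normc (q0%:C)%C), (q0%:C)%C.
by apply: spectrum_ub; split=> //; exists K.
Qed.

End SpectralRadius.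
End PositiveOperator.

(** * Consequences of strong power convergence *)

Lemma subst_op_linear (R : realType) (A : compactHausdorffType)
    (rho : substitution A) : linear (@subst_op R A rho).
Proof.
move=> c f g; apply/val_inj/funext => a.
rewrite -[RHS]/(c * (\sum_(b <- rho a) f b) + \sum_(b <- rho a) g b).
by rewrite mulr_sumr -big_split.
Qed.

HB.instance Definition _ (R : realType) (A : compactHausdorffType)
    (rho : substitution A) :=
  GRing.isLinear.Build R (cfun R A) (cfun R A) _ (@subst_op R A rho)
    (@subst_op_linear R A rho).

Lemma continuous_deviation (R : realType) (X : topologicalType) (f g : X -> R)
    (c e : R) : continuous f -> continuous g ->
  continuous (fun x => `|f x - c * g x| - e * g x).
Proof.
move=> fc gc x; apply: cvgB; last by apply: cvgM; [exact: cvg_cst|exact: gc].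
apply: cvg_norm; apply: cvgB; first exact: fc.
by apply: cvgM; [exact: cvg_cst|exact: gc].
Qed.

Section PowerConvergence.
Variables (R : realType) (A : compactHausdorffType) (rho : substitution A).
Hypothesis rho_long : exists a : A, (2 <= size (rho a))%N.
Hypothesis rho_primitive : primitive_subst rho.
Let M : {linear cfun R A -> cfun R A} := @subst_op R A rho.
Let r : R := spectral_radius M.
Let T (f : cfun R A) := r^-1 *: M f.
Hypothesis T_conv : strongly_power_convergent T.
Implicit Types (f g : cfun R A) (a b : A) (n : nat).
Let one : cfun R A := cfun_cst A 1.

Let M_pos f : (forall a, 0 <= f a) -> forall a, 0 <= M f a.
Proof. by move=> f0 a; apply: sumr_ge0. Qed.

Let iter_oneE n a : iter n M one a = (size (subst_iter rho n a))%:R.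
Proof.
rewrite [LHS]iter_subst_opE -sum1_size natr_sum; exact: eq_bigr.
Qed.

Let M1 a : 1 <= M one a.
Proof.
by have := iter_oneE 1 a => /= ->; rewrite ler1n (size_subst_iter_gt0 rho 1).
Qed.

Let a0 : A := proj1_sig (cid rho_long).

Lemma subst_radius_ge1 : 1 <= r.
Proof. exact: (spectral_radius_pos_ge1 M_pos M1 a0). Qed.

Let r0 : 0 < r.
Proof. exact: lt_le_trans ltr01 subst_radius_ge1. Qed.

Let iterTE n f : iter n T f = r ^- n *: iter n M f.
Proof.
elim: n => [|n IH]; first by rewrite expr0 invr1 scale1r.
by rewrite !iterS IH /T linearZ /= scalerA exprS invfM.
Qed.

Let P f := limn (fun n => iter n T f).
Let cvg_P f : iter n T f @[n --> \oo] --> P f.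
Proof. exact: T_conv. Qed.
Let h := P one.

Let TlinB f g : T f - T g = T (f - g).
Proof. by rewrite /T linearB scalerBr. Qed.

Let TlinZ c f : T (c *: f) = c *: T f.
Proof. by rewrite /T [M _]linearZ /= !scalerA mulrC. Qed.

Let T_continuous : continuous T.
Proof.
apply: (@lipschitz_continuous _ _ _ _ (r^-1 * `|M one|)) => f g.
rewrite TlinB normrZ ger0_norm ?invr_ge0 ?(ltW r0)// -mulrA.
rewrite ler_wpM2l ?invr_ge0 ?(ltW r0)//; apply: cfun_norm_le => [|a].
  by rewrite mulr_ge0.
apply: le_trans (normr_iter_pos M_pos 1 _ a) _; rewrite mulrC ler_wpM2r//.
by rewrite (le_trans (ler_norm _))// le_cfun_norm.
Qed.

Let P_fixed f : T (P f) = P f.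
Proof.
have c1 : iter n.+1 T f @[n --> \oo] --> P f.
  by rewrite (cvg_shiftS (fun n => iter n T f)); exact: cvg_P.
rewrite -[RHS](cvg_lim _ c1)//; apply/esym/cvg_lim => //.
by apply: continuous_cvg; [exact: T_continuous|exact: cvg_P].
Qed.

Let iter_fixed n f : T f = f -> iter n T f = f.
Proof. by move=> fT; elim: n => //= n ->. Qed.

(** By primitivity every [rho^p(a)] contains a letter of the open set where [g] is positive, and
    [g a = T^p g a] is [r^-p] times the sum of [g] over the letters of [rho^p(a)]. *)
Let fixed_pos g : T g = g -> (forall a, 0 <= g a) -> (exists a, 0 < g a) ->
  forall a, 0 < g a.
Proof.
move=> gT g0 [a1 ga1] a.
have oU : open [set a | 0 < g a].
  have -> : [set a | 0 < g a] = g @^-1` [set x | 0 < x] by [].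
  by apply: open_comp; [move=> x _; exact: cfun_continuous|exact: open_gt].
have [p pP] := rho_primitive oU (ex_intro _ a1 ga1).
rewrite -(iter_fixed p gT) iterTE cfunZE iter_subst_opE.
rewrite mulr_gt0 ?invr_gt0 ?exprn_gt0//.
have [b ba gb] := pP a.
by rewrite (big_rem b)//= ltr_wpDr ?sumr_ge0.
Qed.

Let h_ge0 a : 0 <= h a.
Proof.
have ha : iter n T one a @[n --> \oo] --> h a by apply: cfun_eval_cvg; exact: cvg_P.
rewrite -(cvg_lim _ ha)//; apply: limr_ge; first by apply/cvg_ex; exists (h a).
by apply: nearW => n; rewrite iterTE cfunZE iter_oneE mulr_ge0// invr_ge0 exprn_ge0// ltW.
Qed.

(** By [fixed_pos] it is enough that [h] is not 0. If it were, [r^-n M^n 1] would eventually be at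
    most 1/2, against [spectral_radius_pos_lt]. *)
Let h_gt0 a : 0 < h a.
Proof.
apply: fixed_pos => //; first exact: P_fixed.
apply: contrapT => /forallNP hN.
have h0 : h = 0.
  apply/val_inj/funext => b; apply/eqP; rewrite eq_le h_ge0 andbT leNgt.
  exact/negP/hN.
have /cvgrPdist_le /(_ (2^-1)) := @cvg_P one.
rewrite -/h h0 => /(_ _) [|N _ NP]; first by rewrite invr_gt0.
have [b] := spectral_radius_pos_lt M_pos M1 a0 (ltn0Sn N).
have /= := NP N.+1 (leqnSn N); rewrite sub0r normrN => hb.
rewrite -/r => /lt_geF/negbT/negP; apply.
have := le_trans (le_cfun_norm (iter N.+1 T one) b) hb.
rewrite iterTE cfunZE => /(le_trans (ler_norm _)).
by rewrite ler_pdivrMl ?exprn_gt0.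
Qed.

Let continuous_min (f : A -> R) : continuous f -> exists a, forall b, f a <= f b.
Proof.
move=> fc; have [//||a _ fa] := @compact_EVT_min A R f setT _ (@compactT A).
- by exists a0.
- exact: continuous_subspaceT.
- by exists a => b; apply: fa; rewrite inE.
Qed.

(** Let [a] be a minimum of [g / h], with value [q a]. Then [g - q a *: h] is a nonnegative fixed
    point vanishing at [a], so it is 0 by [fixed_pos]. *)
Let fixed_unique g : T g = g -> exists c, g = c *: h.
Proof.
move=> gT; pose q (b : A) : R := g b / h b.
have qc : continuous q.
  move=> b; apply: cvgM; first exact: cfun_continuous.
  by apply: cvgV; [rewrite gt_eqF|exact: cfun_continuous].
have [a aP] := continuous_min qc; exists (q a).
apply/eqP; rewrite -subr_eq0; apply/eqP/val_inj/funext => b; apply/eqP.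
have d0 b' : 0 <= (g - q a *: h) b'.
  by rewrite cfunBE cfunZE subr_ge0 -ler_pdivlMr ?h_gt0//; exact: aP.
rewrite eq_le d0 andbT leNgt; apply/negP => db.
have := @fixed_pos (g - q a *: h) _ d0 (ex_intro _ b db) a.
rewrite cfunBE cfunZE {1}/q divfK ?gt_eqF// subrr ltxx => /(_ _)/negP; apply => //.
by rewrite -TlinB gT TlinZ P_fixed.
Qed.

(** Primitivity puts a letter with a long image into every [rho^p(a)], so [rho^(p+1)(a)] has at
    least two letters. At a minimum of [h], the equation [M^(p+1) h = r^(p+1) h] then gives
    [r^(p+1) >= 2]. Hence bounded errors vanish after division by [r^n]. *)
Let r_gt1 : 1 < r.
Proof.
pose U : set A := [set a | (2 <= size (rho a))%N].
have oU : open U.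
  rewrite openE => a Ua.
  have : \forall b \near a, size (rho b) = size (rho a).
    by apply: cvg_size_near; exact: subst_continuous.
  by apply: filterS => b; rewrite /U /= => ->.
have [p pP] := rho_primitive oU rho_long.
have [a aP] := continuous_min (@cfun_continuous _ _ h).
have := @iter_fixed p.+1 h (@P_fixed one).
move=> /(congr1 (fun f : cfun R A => f a)); rewrite iterTE cfunZE iter_subst_opE => e.
have : 2 * h a <= \sum_(c <- subst_iter rho p.+1 a) h c.
  apply: le_trans (_ : \sum_(c <- subst_iter rho p.+1 a) h a <= _); last exact: ler_sum.
  rewrite big_const_seq count_predT iter_addr addr0 -[leRHS]mulr_natl ler_wpM2r//.
  rewrite ler_nat -add1n (subst_iterD rho 1) size_flatten /shape -map_comp.
  have [b ba Ub] := pP a.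
  rewrite sumnE big_map (big_rem b)//; apply: leq_trans (leq_addr _ _).
  by rewrite -[X in (_ <= X)%N]/(size (subst_iter rho 1 b)) subst_iter1.
have : \sum_(c <- subst_iter rho p.+1 a) h c = r ^+ p.+1 * h a.
  by rewrite -[in RHS]e mulrA divff ?mul1r// gt_eqF// exprn_gt0.
move=> ->; rewrite ler_pM2r// => r2; rewrite ltNge; apply/negP => r1.
have rp : r ^+ p.+1 <= 1 by rewrite exprn_ile1// ltW.
by have := le_trans r2 rp; rewrite leNgt ltr1n.
Qed.

Let T_one_bounded : exists2 B, 0 < B & forall n, `|iter n T one| <= B.
Proof.
have [B [Br BP]] := cvg_seq_bounded (@T_conv one).
exists (`|B| + 1) => [|n]; first by rewrite ltr_wpDl.
by apply: (BP (`|B| + 1)) => //; rewrite (le_lt_trans (ler_norm B))// ltrDl.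
Qed.

Let size_eq n b : (size (subst_iter rho n b))%:R = r ^+ n * iter n T one b.
Proof.
by rewrite iterTE cfunZE mulrA divff ?mul1r ?iter_oneE// expf_neq0// gt_eqF.
Qed.

Let h_min : exists2 e, 0 < e & forall b, e <= h b.
Proof. by have [a aP] := continuous_min (@cfun_continuous _ _ h); exists (h a). Qed.

(** The functions [r^-n |rho^n(b)|] of [b] converge uniformly to [h], which has a positive
    minimum. *)
Let size_lower : exists2 e, 0 < e &
  \forall n \near \oo, forall b, e * r ^+ n <= (size (subst_iter rho n b))%:R.
Proof.
have [e e0 eh] := h_min; exists (e / 2); first by rewrite divr_gt0.
have /cvgrPdist_le /(_ (e / 2)) := @cvg_P one.
move=> /(_ (divr_gt0 e0 (ltr0Sn _ _))); apply: filterS => n hn b.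
rewrite size_eq mulrC ler_wpM2l ?exprn_ge0 ?(ltW r0)//.
have := le_trans (le_cfun_norm (P one - iter n T one) b) hn.
by rewrite cfunBE ler_norml => /andP[_]; have := eh b; rewrite /h; lra.
Qed.

Let cvg_rV (D : R) : r ^- n * D @[n --> \oo] --> (0 : R).
Proof.
rewrite -(mul0r D); apply: cvgMl.
rewrite (_ : (fun n => r ^- n) = (fun n => r^-1 ^+ n)); last first.
  by apply/funext => n; rewrite exprVn.
by apply: cvg_expr; rewrite ger0_norm ?invr_ge0 ?ltW// invf_lt1.
Qed.

Lemma size_subst_iter_large (N : nat) :
  \forall n \near \oo, forall b, (N <= size (subst_iter rho n b))%N.
Proof.
have [e e0 eP] := size_lower.
have /cvgrPdist_le /(_ 1 ltr01) := cvg_rV (N%:R / e).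
move: eP; apply: filterS2 => n eP; rewrite sub0r normrN => rn b.
rewrite -(ler_nat R); apply: le_trans (eP b); rewrite mulrC -ler_pdivrMr//.
rewrite -[leRHS]mulr1 -ler_pdivrMl ?exprn_gt0//.
exact: le_trans (ler_norm _) rn.
Qed.

(** * Almost additive functions on the language *)

Section QuasiAdditive.
Variables (S : word A -> R) (C : R).
Hypothesis S_continuous : continuous S.
Hypothesis S_quasi : forall u v : word A, `|S (u ++ v) - S u - S v| <= C.

Let C0 : 0 <= C. Proof. exact: le_trans (S_quasi [::] [::]). Qed.

(** One defect [C] for each concatenation, and one more for [S [::]] at the end. *)
Lemma quasi_additive_flatten (ws : seq (word A)) :
  `|S (flatten ws) - \sum_(w <- ws) S w| <= C * (size ws).+1%:R.
Proof.
elim: ws => [|w ws IH] /=.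
  have := S_quasi [::] [::]; rewrite /= subrr sub0r normrN => SC.
  by rewrite big_nil subr0 mulr1.
rewrite big_cons.
rewrite (_ : S (w ++ flatten ws) - (S w + \sum_(w <- ws) S w) =
  (S (w ++ flatten ws) - S w - S (flatten ws)) +
  (S (flatten ws) - \sum_(w <- ws) S w)); last by ring.
apply: le_trans (ler_normD _ _) _; rewrite -natr1 mulrDr mulr1 addrC.
by rewrite lerD.
Qed.

Let S_iter_cfun n : (fun b => S (subst_iter rho n b)) \in @is_cfun R A.
Proof.
apply/mem_set => b; apply: (@continuous_comp _ _ _ (subst_iter rho n) S).
  exact: subst_iter_continuous.
exact: S_continuous.
Qed.

Let G n : cfun R A := r ^- n *: CFun (S_iter_cfun n).

(** Cut [rho^(m+k)(b)] into the blocks [rho^m(c)] over the letters [c] of [rho^k(b)]. There are at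
    most [2 |rho^k(b)|] defects, and [r^-k |rho^k(b)|] is the value of [T^k 1] at [b], at most [B].
    The error is small for large [m], uniformly in [k]. *)
Let G_iter B m k : (forall n, `|iter n T one| <= B) ->
  `|G (m + k) - iter k T (G m)| <= r ^- m * (2 * C * B).
Proof.
move=> BP; have rm0 n : 0 <= r ^- n by rewrite invr_ge0 exprn_ge0// ltW.
apply: cfun_norm_le => [|b].
  by rewrite !mulr_ge0// (le_trans _ (BP 0%N)).
rewrite cfunBE iterTE !cfunZE iter_subst_opE.
rewrite (eq_bigr (fun c => r ^- m * S (subst_iter rho m c))); last by [].
rewrite -mulr_sumr mulrA [r ^- k * _]mulrC -invfM -exprD -mulrBr.
rewrite normrM ger0_norm// exprD invfM -[leLHS]mulrA ler_wpM2l//.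
rewrite /= subst_iterD.
have := quasi_additive_flatten [seq subst_iter rho m c | c <- subst_iter rho k b].
rewrite big_map size_map => le1.
apply: le_trans (_ : r ^- k * (2 * C * (size (subst_iter rho k b))%:R) <= _).
  rewrite ler_wpM2l//; apply: le_trans le1 _.
  have : 1 <= (size (subst_iter rho k b))%:R :> R by rewrite ler1n size_subst_iter_gt0.
  rewrite -[(size _).+1%:R]natr1; move: (_%:R) => x x1. by have := C0; nra.
rewrite size_eq mulrCA [r ^- k * _]mulrA mulVf ?mul1r ?expf_neq0 ?gt_eqF//.
rewrite ler_wpM2l ?mulr_ge0// (le_trans (ler_norm _))//.
by rewrite (le_trans (le_cfun_norm _ _)).
Qed.

Let G_cvg : exists c, G n @[n --> \oo] --> c *: h.
Proof.
have [B B0 BP] := T_one_bounded.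
have : cvgn G.
  apply/cauchy_cvgP/cauchyP => e e0.
  have /cvgrPdist_lt /(_ (e / 2) (divr_gt0 e0 (ltr0Sn _ _))) := cvg_rV (2 * C * B).
  move=> [m _ /(_ m (leqnn m))] /=; rewrite sub0r normrN.
  move=> /(le_lt_trans (ler_norm _)) me.
  (* For [n = m + k], [G n] is within [e / 2] of [T^k (G m)] by the choice of [m], and the latter
     tends to [P (G m)]. *)
  exists (P (G m)).
  have /cvgrPdist_lt /(_ (e / 2) (divr_gt0 e0 (ltr0Sn _ _))) := @cvg_P (G m).
  move=> [N _ NP]; exists (m + N)%N => // n /= mNn.
  have mn : (m <= n)%N by apply: leq_trans mNn; exact: leq_addr.
  rewrite -(subnKC mn); set k := (n - m)%N.
  have /NP /= hk : (N <= k)%N by rewrite leq_subRL.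
  rewrite -ball_normE /= [e](splitr e) -[P (G m)](subrK (iter k T (G m))) -addrA.
  apply: le_lt_trans (ler_normD _ _) _; rewrite ltrD//.
  rewrite distrC; apply: le_lt_trans me; exact: G_iter.
move=> /cvg_ex[g Gg].
(* The case [k = 1] of [G_iter] makes the limit a fixed point, hence a multiple of [h]. *)
have gT : T g = g.
  have d0 : G n.+1 - T (G n) @[n --> \oo] --> 0.
    apply/cvgrPdist_lt => e e0.
    have /cvgrPdist_lt /(_ e e0) := cvg_rV (2 * C * B).
    apply: filterS => n; rewrite !sub0r !normrN => /(le_lt_trans (ler_norm _)) hn.
    by apply: le_lt_trans hn; have := @G_iter B n 1 BP; rewrite addn1.
  have d1 : G n.+1 - T (G n) @[n --> \oo] --> g - T g.
    apply: cvgB; first by rewrite (cvg_shiftS G).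
    by apply: continuous_cvg; [exact: T_continuous|].
  apply/esym/eqP; rewrite -subr_eq0; apply/eqP.
  by rewrite -(cvg_lim _ d1)// (cvg_lim _ d0).
by have [c cP] := fixed_unique gT; exists c; rewrite -cP.
Qed.

Lemma quasi_additive_iter : exists c, forall e, 0 < e ->
  \forall n \near \oo, forall b, `|S (subst_iter rho n b) -
    c * (size (subst_iter rho n b))%:R| <= e * (size (subst_iter rho n b))%:R.
Proof.
have [c cG] := G_cvg; exists c => e e0.
have [d d0 dP] := size_lower.
have : G n - c *: iter n T one @[n --> \oo] --> 0.
  by rewrite -(subrr (c *: h)); apply: cvgB => //; apply: cvgZr; exact: cvg_P.
(* The factor [d] of [size_lower] converts an error relative to [r^n] into one relative to the
   length of [rho^n(b)]. *)
move=> /cvgrPdist_le /(_ (e * d) (mulr_gt0 e0 d0)).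
move: dP; apply: filterS2 => n dP; rewrite sub0r normrN => Gn b.
apply: le_trans (_ : e * (d * r ^+ n) <= _); last by rewrite ler_wpM2l// ltW.
rewrite mulrA; have rn : 0 < r ^+ n by rewrite exprn_gt0.
rewrite -ler_pdivrMr//; apply: le_trans Gn.
apply: le_trans (le_cfun_norm _ b); rewrite cfunBE !cfunZE.
rewrite -[X in _ / X](gtr0_norm rn) -normf_div le_eqVlt; apply/orP; left; apply/eqP.
congr `| _ |; rewrite size_eq /=; field; exact: lt0r_neq0.
Qed.

Let S_short : exists2 B, 0 <= B & forall w : word A, `|S w| <= B * (size w).+1%:R.
Proof.
(* Here [f] is [S] on words of one letter, bounded by compactness; [w] is then split into its
   letters. *)
pose f := CFun (S_iter_cfun 0); exists (`|f| + C) => [|w]; first by rewrite addr_ge0.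
have := quasi_additive_flatten [seq [:: b] | b <- w].
rewrite flatten_seq1 big_map size_map => hS.
rewrite (_ : S w = S w - \sum_(b <- w) S [:: b] + \sum_(b <- w) S [:: b]).
  apply: le_trans (ler_normD _ _) _; rewrite mulrDl addrC lerD//.
  apply: le_trans (ler_norm_sum _ _ _) _.
  apply: le_trans (_ : \sum_(b <- w) `|f| <= _).
    by apply: ler_sum => b _; exact: (le_cfun_norm f b).
  rewrite big_const_seq count_predT iter_addr addr0 -[leLHS]mulr_natr.
  by rewrite ler_wpM2l// ler_nat.
by rewrite subrK.
Qed.

Lemma quasi_additive_language : exists c, forall e, 0 < e -> exists K,
  forall u, language rho u -> `|S u - c * (size u)%:R| <= e * (size u)%:R + K.
Proof.
have [c cP] := quasi_additive_iter; exists c => e e0.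
(* The blocks [rho^n(b)] deviate by at most [e / 2] of their length, and are so long that the other
   [e / 2] pays for the defect [C]. *)
have [n [nP nN]] : exists n, (forall b, `|S (subst_iter rho n b) -
      c * (size (subst_iter rho n b))%:R| <= e / 2 * (size (subst_iter rho n b))%:R) /\
    (forall b, (Num.truncn (C / (e / 2))).+1 <= size (subst_iter rho n b))%N.
  apply: (@filter_ex _ \oo); apply: filterI; last exact: size_subst_iter_large.
  by apply: cP; rewrite divr_gt0.
have [B B0 SB] := S_short.
have [L LP] : exists L : nat, forall b, (size (subst_iter rho n b) <= L)%N.
  exists (Num.truncn `|iter n M one|) => b.
  rewrite truncn_ge_nat// -iter_oneE.
  exact: le_trans (ler_norm _) (le_cfun_norm _ _).
pose D (u : word A) : R := S u - c * (size u)%:R.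
have D_quasi u v : `|D (u ++ v) - D u - D v| <= C.
  rewrite /D size_cat natrD [X in `|X|](_ : _ = S (u ++ v) - S u - S v) //; ring.
pose K := (B + `|c|) * L.+1%:R.
have D_short w : (size w <= L)%N -> `|D w| <= K.
  move=> wL; have wL' : (size w).+1%:R <= L.+1%:R :> R by rewrite ler_nat ltnS.
  apply: le_trans (ler_normB _ _) _; rewrite /K mulrDl lerD//.
    by apply: le_trans (SB w) _; rewrite ler_wpM2l.
  by rewrite normrM ler_wpM2l// ger0_norm// (le_trans _ wL')// ler_nat.
exists (2 * K + C) => u; rewrite /language => uL.
pose g (u : word A) : R := `|D u| - e * (size u)%:R.
have size_c : continuous (fun u : word A => (size u)%:R : R).
  move=> w; apply: (@cvg_near_cst _ _ _ _ (nbhs w)).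
  by have := size_near w; apply: filterS => v ->.
have gc : continuous g := @continuous_deviation R (word A) S _ c e S_continuous size_c.
(* The estimate is a closed condition on the word, so it passes to the closure of the generated
   words. *)
suff gen : generated rho `<=` [set u : word A | g u <= 2 * K + C].
  have clg : closed [set u : word A | g u <= 2 * K + C].
    have -> : [set u : word A | g u <= 2 * K + C] =
      g @^-1` [set x | x <= 2 * K + C] by [].
    by apply: closed_comp; [move=> x _; exact: gc|exact: closed_le].
  have := closure_subset gen uL; rewrite -((closure_id _).1 clg).
  by rewrite /g /= lerBlDl.
move=> v [a [k /infixP [p [q E]]]] /=; rewrite /g lerBlDl.
have K0 : 0 <= K by rewrite mulr_ge0// addr_ge0.
(* A word generated in fewer than [n] steps is no longer than [L]; any other lies in a concatenation
   of blocks [rho^n(b)]. *)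
have [kn|nk] := ltnP k n.
  have vL : (size v <= L)%N.
    apply: leq_trans (LP a); apply: leq_trans (leq_size_subst_iter rho a (ltnW kn)).
    by rewrite E !size_cat addnCA leq_addr.
  have := D_short _ vL; have : 0 <= e * (size v)%:R by rewrite mulr_ge0// ltW.
  by have := C0; lra.
move: E; rewrite -(subnKC nk) subst_iterD => E.
apply: (quasi_additive_infix (ltW e0) D_quasi D_short _ E) => w /mapP[b _ ->].
split; first exact: LP.
have hb := nP b; rewrite /D.
have : C <= e / 2 * (size (subst_iter rho n b))%:R.
  rewrite mulrC -ler_pdivrMr ?divr_gt0//.
  apply: le_trans (_ : _ <= (Num.truncn (C / (e / 2))).+1%:R) _.
    by rewrite ltW// truncnS_gt.
  by rewrite ler_nat.
lra.
Qed.

End QuasiAdditive.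
End PowerConvergence.

(** * Sequences and subshifts *)

Section UltraLimits.
(** An ultrafilter converges to each of its cluster points. This replaces subsequences, as the
    alphabet may fail to be metrizable. *)
Lemma ultra_compact_cvg (I : Type) (T : topologicalType) (U : set_system I)
    (A : set T) (f : I -> T) :
  UltraFilter U -> compact A -> U (f @^-1` A) -> exists2 l, A l & f @ U --> l.
Proof.
move=> UU Ac UA.
have [l [Al cl]] : A `&` cluster (f @ U) !=set0 by apply: Ac; exact: UA.
exists l => // B lB; have [//|UN] := in_ultra_setVsetC (f @^-1` B) UU.
by have [x [/= nBx Bx]] := cl (~` B) B UN lB.
Qed.

Lemma ultra_nat : exists U : set_system nat, UltraFilter U /\ \oo `<=` U.
Proof. exact: ultraFilterLemma. Qed.
End UltraLimits.

Lemma compact_set_type (T : topologicalType) (A : set T) :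
  compact A -> compact [set: A].
Proof.
move=> Ac F FF _.
have [p [Ap cp]] : A `&` cluster (set_val @ F) !=set0.
  apply: Ac; apply: (@filterS _ F _ setT); last exact: filterT.
  by move=> x _; exact: set_valP.
exists (exist _ p (mem_set Ap)); split=> // B C FB [_ [[C' oC' <-] /= C'p C'C]].
have pC' : nbhs p C' by exact: open_nbhs_nbhs.
have FB' : F (set_val @^-1` (set_val @` B)).
  by apply: filterS FB => x Bx; exists x.
have [x [[y By yx] C'x]] := cp (set_val @` B) C' FB' pC'.
by exists y; split=> //; apply: C'C; rewrite /= yx.
Qed.

Lemma hausdorff_initial (S T : topologicalType) (f : S -> T) :
  continuous f -> injective f -> hausdorff_space T -> hausdorff_space S.
Proof.
move=> fc fi hT p q pq; apply/fi/hT => A B /fc Ap /fc Bq.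
by have [x [Ax Bx]] := pq _ _ Ap Bq; exists (f x).
Qed.

Section Sequences.
Variables (A : compactHausdorffType).
Notation Z := {ptws int -> A}.
Implicit Types (x y : Z) (a : A).

Lemma compact_sequences : compact [set: Z].
Proof.
have := @tychonoff int (fun=> A) (fun=> setT) (fun=> @compactT A).
by congr compact; rewrite eqEsubset; split.
Qed.

Lemma hausdorff_sequences : hausdorff_space Z.
Proof. exact: (@hausdorff_product int (fun=> A) (fun=> @hausdorffT A)). Qed.

Lemma iter_left_shift n x i : iter n (@left_shift A) x i = x (i + n%:Z).
Proof.
elim: n i => [|n IH] i; first by rewrite addr0.
by rewrite iterS /left_shift IH -addrA -PoszD add1n.
Qed.

Lemma iter_left_shift_continuous n : continuous (iter n (@left_shift A)).
Proof.
apply: continuous_ptws => i.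
rewrite (_ : (fun x => _) = fun x : Z => x (i + n%:Z)).
  exact: ptws_eval_continuous.
by apply/funext => x; rewrite iter_left_shift.
Qed.

Lemma size_factor x i n : size (Defs.factor x i n) = n.
Proof. by rewrite size_map size_iota. Qed.

Lemma nth_factor a x i n j : (j < n)%N -> nth a (Defs.factor x i n) j = x (i + j%:Z).
Proof. by move=> jn; rewrite (nth_map 0%N) ?size_iota// nth_iota. Qed.

Lemma factor_continuous i n : continuous (fun x : Z => Defs.factor x i n).
Proof.
move=> x; apply: (@cvg_word A (x 0) Z (nbhs x)).
  by apply: nearW => y; rewrite !size_factor.
rewrite size_factor => j jn.
rewrite (_ : (fun y => _) = fun y : Z => y (i + j%:Z)); last first.
  by apply/funext => y; rewrite nth_factor.
by rewrite nth_factor//; exact: ptws_eval_continuous.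
Qed.

Variable a : A.

(** Negative positions receive mirrored letters. Sums of a local function along [w] feel this only
    near the ends, within a bounded error. *)
Definition pad (w : word A) : Z := fun i => nth a w `|i|%N.

Lemma pad_continuous : continuous pad.
Proof. by apply: continuous_ptws => i; exact: nth_continuous. Qed.

Lemma pad_factor x n i : (i < n)%N -> pad (Defs.factor x 0 n) i%:Z = x i%:Z.
Proof. by move=> ni; rewrite /pad /= nth_factor// add0r. Qed.

Definition trunc (n : nat) x : Z := fun i => if (`|i| <= n)%N then x i else a.

Lemma trunc_continuous n : continuous (trunc n).
Proof.
apply: continuous_ptws => i; rewrite /trunc.
case: leqP => _; [exact: ptws_eval_continuous|exact: cst_continuous].
Qed.

Lemma trunc_eq n x y : (forall i, (`|i| <= n)%N -> x i = y i) ->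
  trunc n x = trunc n y.
Proof. by move=> xy; apply/funext => i; rewrite /trunc; case: ifP => // /xy. Qed.

(** * Cylinder functions and their sums along words *)

Section Cylinder.
Variables (R : realType).

(** If every [n] had a bad point [x n], let [l] be an ultralimit of these. The truncations also tend
    to [l], since coordinate [i] is untouched once [n >= |i|], and continuity at [l] gives a
    contradiction. *)
Lemma trunc_approx (G : Z -> R) (e : R) : continuous G -> 0 < e ->
  exists n, forall x, `|G x - G (trunc n x)| <= e.
Proof.
move=> Gc e0; apply: contrapT => /forallNP N.
have /choice[x xP] n : exists x, e < `|G x - G (trunc n x)|.
  by have /existsNP[x /negP] := N n; rewrite -ltNge; exists x.
have [U [UU U00]] := ultra_nat.
have [l _ xl] := @ultra_compact_cvg _ Z U setT x UU compact_sequences filterT.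
have tl : (fun n => trunc n (x n)) @ U --> l.
  apply: cvg_ptws => i.
  apply: (@cvg_near_eq _ _ _ _ (fun n => x n i)).
    by apply: U00; exists `|i|%N => // n /= ni; rewrite /trunc ni.
  exact: (continuous_cvg _ (@ptws_eval_continuous _ A i l) xl).
have : (fun n => `|G (x n) - G (trunc n (x n))|) @ U --> `|G l - G l|.
  apply: cvg_norm; apply: cvgB; first exact: (continuous_cvg _ (Gc l) xl).
  exact: (continuous_cvg _ (Gc l) tl).
rewrite subrr normr0 => /cvgrPdist_lt /(_ e e0) /filter_ex [n].
by rewrite sub0r normrN normr_id ltNge ltW.
Qed.

Variables (F : Z -> R) (n : nat) (B : R).
Hypothesis F_local : forall x y, (forall i, (`|i| <= n)%N -> x i = y i) -> F x = F y.
Hypothesis F_bound : forall x, `|F x| <= B.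

(** The window of radius [n] around [i] stays inside [[0, N)] except for at most [n] positions at
    each end; each of these costs [2 * B]. *)
Lemma local_sum_dist x y N : (forall i : nat, (i < N)%N -> x i%:Z = y i%:Z) ->
  `|\sum_(i < N) F (iter i (@left_shift A) x) -
    \sum_(i < N) F (iter i (@left_shift A) y)| <= 4 * B * n%:R.
Proof.
move=> xy; have B0 : 0 <= B by exact: le_trans (F_bound x).
rewrite -sumrB; apply: le_trans (ler_norm_sum _ _ _) _.
pose b (i : nat) : R := (i < n)%:R + (N <= i + n)%:R.
apply: le_trans (_ : \sum_(i < N) 2 * B * b i <= _).
  apply: ler_sum => i _; rewrite /b; have [|ni] := ltnP i n => [_|].
    apply: le_trans (ler_normB _ _) _; rewrite mulrDr.
    have : 0 <= 2 * B * (N <= i + n)%:R by rewrite !mulr_ge0.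
    have := F_bound (iter i (@left_shift A) x).
    have := F_bound (iter i (@left_shift A) y); rewrite /=; lra.
  have [|iN] := leqP N (i + n) => [_|].
    apply: le_trans (ler_normB _ _) _.
    have := F_bound (iter i (@left_shift A) x).
    have := F_bound (iter i (@left_shift A) y); rewrite /=; lra.
  rewrite (F_local (y := iter i (@left_shift A) y)) ?subrr ?normr0 ?addr0 ?mulr0//.
  move=> j jn; rewrite !iter_left_shift.
  have [k kN ->] : exists2 k : nat, (k < N)%N & j + i%:Z = k%:Z.
    by have := ltn_ord i; exists (absz (j + i%:Z)); lia.
  exact: xy.
rewrite -mulr_sumr big_split /=.
have h m : (\sum_(i < m) (i < n) <= n)%N.
  suff -> : (\sum_(i < m) (i < n) = minn m n)%N by exact: geq_minr.
  elim: m => [|m IH]; first by rewrite big_ord0 min0n.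
  by rewrite big_ord_recr IH /=; lia.
have h1 : \sum_(i < N) (i < n)%:R <= n%:R :> R by rewrite -natr_sum ler_nat.
have h2 : \sum_(i < N) (N <= i + n)%:R <= n%:R :> R.
  rewrite -natr_sum ler_nat; apply: leq_trans (h N).
  (* Reversing the positions turns the right end into the left one. *)
  rewrite (reindex_inj rev_ord_inj) /=; apply: leq_sum => i _.
  by have := ltn_ord i; case: leqP; case: ltnP; lia.
have -> : 4 * B * n%:R = 2 * B * (n%:R + n%:R) by ring.
by rewrite ler_wpM2l ?mulr_ge0// lerD.
Qed.

Hypothesis F_continuous : continuous F.

Definition word_sum (w : word A) : R :=
  \sum_(i < size w) F (iter i (@left_shift A) (pad w)).

Lemma word_sum_continuous : continuous word_sum.
Proof.
move=> w; pose s (v : word A) := \sum_(i < size w) F (iter i (@left_shift A) (pad v)).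
apply: (@cvg_near_eq _ _ (nbhs w) _ s).
  by have := size_near w; apply: filterS => v vw; rewrite /word_sum vw.
suff : continuous s by apply.
apply: continuous_big => [|i _ v]; first exact: add_continuous.
apply: (@continuous_comp _ _ _ pad (fun x => F (iter i (@left_shift A) x))).
  exact: pad_continuous.
apply: continuous_comp; first exact: iter_left_shift_continuous.
exact: F_continuous.
Qed.

(** The sequence [pad (u ++ v)] agrees with [pad u] on the positions of [u] and, shifted by
    [size u], with [pad v] on those of [v]: twice the bound of [local_sum_dist]. *)
Lemma word_sum_quasi (u v : word A) :
  `|word_sum (u ++ v) - word_sum u - word_sum v| <= 8 * B * n%:R.
Proof.
rewrite /word_sum size_cat big_split_ord /=.
set s1 := \sum_(i < size u) _; set s2 := \sum_(i < size v) _.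
set s3 := \sum_(i < size u) _; set s4 := \sum_(i < size v) _.
have -> : s1 + s2 - s3 - s4 = (s1 - s3) + (s2 - s4) by ring.
have -> : 8 * B * n%:R = 4 * B * n%:R + 4 * B * n%:R by ring.
apply: le_trans (ler_normD _ _) _; apply: lerD.
  by apply: local_sum_dist => i iu; rewrite /pad /= nth_cat iu.
rewrite (_ : s2 = \sum_(i < size v)
    F (iter i (@left_shift A) (iter (size u) (@left_shift A) (pad (u ++ v))))).
  apply: local_sum_dist => i iv; rewrite iter_left_shift -PoszD /pad /=.
  by rewrite nth_cat ltnNge leq_addl addnK.
by apply: eq_bigr => i _; rewrite addnC iterD.
Qed.

Lemma word_sum_factor x N :
  `|\sum_(i < N) F (iter i (@left_shift A) x) - word_sum (Defs.factor x 0 N)|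
    <= 4 * B * n%:R.
Proof.
rewrite /word_sum size_factor; apply: local_sum_dist => i iN.
by rewrite pad_factor.
Qed.
End Cylinder.

(* The hypothesis on rho is the conclusion of [quasi_additive_language]. *)
Lemma uniform_averages (R : realType) (rho : substitution A) :
  (forall (S : word A -> R) (C : R), continuous S ->
    (forall u v : word A, `|S (u ++ v) - S u - S v| <= C) ->
    exists c, forall e, 0 < e -> exists K, forall u, language rho u ->
      `|S u - c * (size u)%:R| <= e * (size u)%:R + K) ->
  forall (G : Z -> R) (e : R), continuous G -> 0 < e ->
  exists (c : R) (N : nat), (0 < N)%N /\ forall x, subshift rho x ->
    `|\sum_(i < N) G (iter i (@left_shift A) x) - c * N%:R| <= e * N%:R.
Proof.
move=> QL G e Gc e0.
have e30 : 0 < e / 3 by rewrite divr_gt0.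
have [n Gn] := trunc_approx Gc e30.
pose F := G \o trunc n.
have Fc : continuous F.
  by move=> x; apply: continuous_comp; [exact: trunc_continuous|exact: Gc].
have Fl x y : (forall i, (`|i| <= n)%N -> x i = y i) -> F x = F y.
  by move=> xy; rewrite /F /= (trunc_eq xy).
have [B FB] : exists B, forall x, `|F x| <= B.
  have cK : compact (range F).
    apply: continuous_compact compact_sequences.
    exact: continuous_subspaceT.
  have [B [_ BP]] := compact_bounded cK.
  by exists (B + 1) => x; apply: (BP (B + 1)); [rewrite ltrDl|exists x].
have [c cP] := QL _ _ (word_sum_continuous Fc) (word_sum_quasi Fl FB).
have [K KP] := cP _ e30.
(* A third of [e] goes to replacing [G] by [F], a third to the linear part of the deviation of the
   word sum, and a third to the constants, which this [N] absorbs. *)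
pose N := (Num.truncn ((`|K| + 4 * B * n%:R) / (e / 3))).+1.
exists c, N; split=> // x xX.
have NK : `|K| + 4 * B * n%:R <= e / 3 * N%:R.
  by rewrite [leRHS]mulrC -ler_pdivrMr// ltW// /N truncnS_gt.
have h1 := KP _ (xX 0 N); rewrite size_factor in h1.
have h2 := word_sum_factor Fl FB x N.
have h3 : `|\sum_(i < N) G (iter i (@left_shift A) x) -
    \sum_(i < N) F (iter i (@left_shift A) x)| <= e / 3 * N%:R.
  rewrite -sumrB; apply: le_trans (ler_norm_sum _ _ _) _.
  apply: le_trans (_ : \sum_(i < N) e / 3 <= _); first by apply: ler_sum => i _.
  by rewrite sumr_const card_ord mulr_natr.
move: h1 h2 h3 NK (ler_norm K).
set s1 := \sum_(i < N) _; set s2 := \sum_(i < N) _; set w := word_sum _ _.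
rewrite !ler_norml; move: (`|K|) => K' /andP[? ?] /andP[? ?] /andP[? ?] ? ?.
by apply/andP; split; lra.
Qed.

Lemma subshift_closed (rho : substitution A) : closed (subshift rho).
Proof.
have -> : subshift rho = \bigcap_i \bigcap_n
    ((fun x : Z => Defs.factor x i n) @^-1` language rho).
  by rewrite eqEsubset; split=> [x xX i _ n _|x xX i n]; [exact: xX|exact: xX].
apply: closed_bigI => i _; apply: closed_bigI => n _.
apply: closed_comp; first by move=> x _; exact: factor_continuous.
exact: closed_closure.
Qed.

Lemma subshift_compact (rho : substitution A) : compact [set: subshift rho].
Proof.
apply: compact_set_type; apply: subclosed_compact compact_sequences _ => //.
exact: subshift_closed.
Qed.

Lemma subshift_hausdorff (rho : substitution A) :
  hausdorff_space (subshift rho : topologicalType).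
Proof.
apply: (@hausdorff_initial _ Z set_val).
- exact: initial_continuous.
- exact: val_inj.
- exact: hausdorff_sequences.
Qed.

Lemma subshift_map_continuous (rho : substitution A) :
  continuous (@subshift_map A rho).
Proof.
move=> x B [_ [[C oC <-] /= Cx CB]].
have vc : continuous (iter 1 (@left_shift A) \o (set_val : subshift rho -> Z)).
  move=> y; apply: continuous_comp; first exact: initial_continuous.
  exact: iter_left_shift_continuous.
have : nbhs x ((iter 1 (@left_shift A) \o set_val) @^-1` C).
  by apply: vc; apply: open_nbhs_nbhs.
by apply: filterS => y Cy; apply: CB.
Qed.

(** Ever longer words are placed around 0. In an ultralimit every finite window is a limit of
    generated words, and the language is closed. *)
Lemma subshift_nonempty (rho : substitution A) :
  (forall N, exists n, forall b, (N <= size (subst_iter rho n b))%N) ->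
  subshift rho !=set0.
Proof.
move=> long.
have /choice[k kP] N := long N.
(* With length at least [2 N] and position [N] moved to 0, the word fills [[-N, N)]; farther left,
   [absz] merely keeps the index total. *)
pose w N : word A := subst_iter rho (k N.*2) a.
have wN N : (N.*2 <= size (w N))%N by exact: kP.
pose x (N : nat) : Z := fun i => nth a (w N) (absz (i + N%:Z)).
have [U [UU U00]] := ultra_nat.
have [l _ xl] := @ultra_compact_cvg _ Z U setT x UU compact_sequences filterT.
exists l => i n.
apply: (@closed_cvg _ _ U _ (fun N => Defs.factor (x N) i n) (language rho)).
- exact: closed_closure.
- apply: U00; exists (`|i| + n)%N => // N /= iN; apply: subset_closure.
  exists a, (k N.*2); apply/infixP; rewrite -/(w N).
  pose j := absz (i + N%:Z).
  exists (take j (w N)), (drop n (drop j (w N))).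
  have -> : Defs.factor (x N) i n = take n (drop j (w N)).
    have sN : (j + n <= size (w N))%N by apply: leq_trans (wN N); rewrite /j; lia.
    apply: (@eq_from_nth _ a).
      by rewrite size_factor size_takel// size_drop; lia.
    move=> m; rewrite size_factor => mn; rewrite nth_factor// nth_take// nth_drop /x.
    by congr nth; rewrite /j; lia.
  by rewrite cat_take_drop cat_take_drop.
- exact: (continuous_cvg _ (@factor_continuous i n l) xl).
Qed.
End Sequences.

(** * Regular invariant measures *)

Section Regularization.
Variables (R : realType) (X : topologicalType) (x0 : X).
Hypotheses (X_compact : compact [set: X]) (X_hausdorff : hausdorff_space X).
Variable m : set X -> R.
Hypothesis m_ge0 : forall A, 0 <= m A.
Hypothesis mU : forall A B, A `&` B = set0 -> m (A `|` B) = m A + m B.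
Hypothesis mT : m setT = 1.
Local Open Scope ereal_scope.
Implicit Types (A B K L U V : set X).

Let le_m A B : A `<=` B -> (m A <= m B)%R.
Proof.
move=> AB; rewrite -(setDUK AB) mU ?lerDl//.
by rewrite setDE setICA setICr setI0.
Qed.

Let m0 : m set0 = 0%R.
Proof. by have := mU (setI0 set0); rewrite setU0; lra. Qed.

Let le_mU A B : (m (A `|` B) <= m A + m B)%R.
Proof.
have -> : A `|` B = A `|` (B `\` A).
  rewrite eqEsubset; split=> x [Ax|]; try by left.
    by move=> Bx; have [Ax|nAx] := pselect (A x); [left|right].
  by move=> [Bx _]; right.
rewrite mU; last by rewrite setDE setICA setICr setI0.
by rewrite lerD2l; apply: le_m; exact: subDsetl.
Qed.

(** The finitely additive [m] may be far from regular: open sets are measured from inside by closed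
    sets, then arbitrary sets from outside by open ones. *)
Definition open_content U : \bar R :=
  ereal_sup [set (m K)%:E | K in [set K | closed K /\ K `<=` U]].

Definition regularization A : \bar R :=
  ereal_inf [set open_content U | U in [set U | open U /\ A `<=` U]].

Let m_le_content K U : closed K -> K `<=` U -> (m K)%:E <= open_content U.
Proof. by move=> cK KU; apply: ereal_sup_ubound; exists K. Qed.

Let le_content U V : U `<=` V -> open_content U <= open_content V.
Proof.
move=> UV; apply: ge_ereal_sup => _ [K [cK KU] <-]; apply: m_le_content => //.
exact: subset_trans UV.
Qed.

Let content_ge0 U : 0 <= open_content U.
Proof.
by apply: le_trans (m_le_content closed0 (@sub0set _ U)); rewrite m0.
Qed.

Let content0 : open_content set0 = 0.
Proof.
apply/eqP; rewrite eq_le content_ge0 andbT; apply: ge_ereal_sup.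
by move=> _ [K [_ K0] <-]; move: K0; rewrite subset0 => ->; rewrite m0.
Qed.

Let contentT : open_content setT = 1.
Proof.
apply/eqP; rewrite eq_le; apply/andP; split.
  apply: ge_ereal_sup => _ [K _ <-]; rewrite lee_fin -mT; exact: le_m.
by apply: le_trans (m_le_content closedT (@subset_refl _ setT)); rewrite mT.
Qed.

Let X_normal : normal_space X.
Proof. exact: compact_normal. Qed.

(** Normality separates the parts of [K] outside [U] and outside [V] by disjoint open sets, which
    are then removed from [K]. This serves the subadditivity of the content. *)
Let split_closed K U V : closed K -> open U -> open V -> K `<=` U `|` V ->
  exists K1 K2, [/\ closed K1, closed K2, K1 `<=` U, K2 `<=` V & K `<=` K1 `|` K2].
Proof.
move=> cK oU oV KUV.
have cl1 : closed (K `&` ~` U) by apply: closedI => //; exact: open_closedC.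
have cl2 : closed (K `&` ~` V) by apply: closedI => //; exact: open_closedC.
have cl0 : (K `&` ~` U) `&` (K `&` ~` V) = set0.
  by rewrite eqEsubset; split=> // x [[Kx nUx] [_ nVx]]; case: (KUV x Kx).
have [P [Q [oP oQ KP KQ PQ]]] := (@normal_openP R X).1 X_normal _ _ cl1 cl2 cl0.
exists (K `&` ~` P), (K `&` ~` Q); split.
- by apply: closedI => //; exact: open_closedC.
- by apply: closedI => //; exact: open_closedC.
- by move=> x [Kx nPx]; apply: contrapT => nUx; apply: nPx; exact: KP.
- by move=> x [Kx nQx]; apply: contrapT => nVx; apply: nQx; exact: KQ.
- move=> x Kx; have [Px|nPx] := pselect (P x); last by left.
  right; split=> // Qx; suff : set0 x by [].
  by rewrite -PQ.
Qed.

Let contentU U V : open U -> open V ->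
  open_content (U `|` V) <= open_content U + open_content V.
Proof.
move=> oU oV; apply: ge_ereal_sup => _ [K [cK KUV] <-].
have [K1 [K2 [cK1 cK2 K1U K2V KK]]] := split_closed cK oU oV KUV.
apply: le_trans (_ : (m K1 + m K2)%:E <= _).
  by rewrite lee_fin (le_trans (le_m KK))// le_mU.
by rewrite EFinD leeD// m_le_content.
Qed.

Let content_bigU (F : nat -> set X) n : (forall i, open (F i)) ->
  open_content (\big[setU/set0]_(i < n) F i) <= \sum_(i < n) open_content (F i).
Proof.
move=> oF; elim: n => [|n IH]; first by rewrite !big_ord0 content0.
rewrite !big_ord_recr /=; apply: le_trans (contentU _ (oF n)) _.
  by rewrite -bigcup_mkord; apply: bigcup_open => i _; exact: oF.
by rewrite leeD2r.
Qed.

(** If no finite union suffices, uncovered points [x n] have an ultralimit in some [F i], though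
    [x n] avoids [F i] once [n > i]. *)
Let compact_bigcup K (F : nat -> set X) : closed K -> (forall i, open (F i)) ->
  K `<=` \bigcup_i F i -> exists n, K `<=` \big[setU/set0]_(i < n) F i.
Proof.
move=> cK oF KF; apply: contrapT => /forallNP N.
have /choice[x xP] n : exists x, K x /\ ~ (\big[setU/set0]_(i < n) F i) x.
  by have /existsNP[x /not_implyP] := N n; exists x.
have [U [UU U00]] := ultra_nat.
have cpK : compact K by apply: subclosed_compact X_compact _.
have [|l Kl xl] := @ultra_compact_cvg _ X U K x UU cpK.
  by apply: (@filterS _ _ _ setT); [move=> n _; exact: (xP n).1|exact: filterT].
have [i _ Fil] := KF l Kl.
have : U [set n | (i < n)%N] by apply: U00; exists i.+1.
have : U (x @^-1` F i) by apply: xl; exact: open_nbhs_nbhs.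
move=> U1 U2; have [n [/= Fx ni]] := filter_ex (filterI U1 U2).
by apply: (xP n).2; rewrite -bigcup_mkord; exists i.
Qed.

Let content_bigcup (F : nat -> set X) : (forall i, open (F i)) ->
  open_content (\bigcup_i F i) <= \sum_(i <oo) open_content (F i).
Proof.
move=> oF; apply: ge_ereal_sup => _ [K [cK KF] <-].
have [n Kn] := compact_bigcup cK oF KF.
apply: le_trans (m_le_content cK Kn) _; apply: le_trans (content_bigU n oF) _.
by rewrite -(big_mkord xpredT (fun i => open_content (F i))); apply: nneseries_lim_ge.
Qed.

Let regularization_open U : open U -> regularization U = open_content U.
Proof.
move=> oU; apply/eqP; rewrite eq_le; apply/andP; split.
  by apply: ereal_inf_lbound; exists U => //; split.
by apply: le_ereal_inf_tmp => _ [V [oV UV] <-]; exact: le_content.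
Qed.

Let regularization0 : regularization set0 = 0.
Proof. by rewrite regularization_open; [exact: content0|exact: open0]. Qed.

Let regularization_ge0 A : 0 <= regularization A.
Proof. by apply: le_ereal_inf_tmp => _ [V [oV UV] <-]. Qed.

Let le_regularization : {homo regularization : A B / A `<=` B >-> A <= B}.
Proof.
move=> A B AB; apply: le_ereal_inf_tmp => _ [V [oV BV] <-].
by apply: ereal_inf_lbound; exists V => //; split=> //; exact: subset_trans BV.
Qed.

Let regularization_le1 A : regularization A <= 1.
Proof.
by rewrite -contentT -regularization_open; [exact: le_regularization|exact: openT].
Qed.

Let regularization_fin A : regularization A \is a fin_num.
Proof.
rewrite ge0_fin_numE ?regularization_ge0//.
by apply: le_lt_trans (regularization_le1 A) _; rewrite ltry.
Qed.

Let regularization_approx A (e : R) : (0 < e)%R ->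
  exists U, [/\ open U, A `<=` U & open_content U <= regularization A + e%:E].
Proof.
move=> e0; have [_ [U [oU AU] <-] /ltW Ue] :=
  lb_ereal_inf_adherent e0 (regularization_fin A).
by exists U.
Qed.

Let regularization_sigma : sigma_subadditive regularization.
Proof.
move=> F; apply/lee_addgt0Pr => e e0.
have /choice[U UP] i : exists U, [/\ open U, F i `<=` U &
    open_content U <= regularization (F i) + (e / (2 ^ i.+1)%:R)%:E].
  by apply: regularization_approx; rewrite divr_gt0// ltr0n expn_gt0.
apply: le_trans (epsilon_trick xpredT _ (ltW e0)); last first.
  by move=> n; exact: regularization_ge0.
apply: le_trans (_ : open_content (\bigcup_i U i) <= _).
  apply: ereal_inf_lbound; exists (\bigcup_i U i) => //; split.
    by apply: bigcup_open => i _; case: (UP i).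
  by apply: subset_bigcup => i _; case: (UP i).
apply: le_trans (content_bigcup _) _; first by move=> i; case: (UP i).
by apply: lee_nneseries => // i _; case: (UP i).
Qed.

Let Y : pointedType := borel x0.

Let mu : {outer_measure set Y -> \bar R} :=
  HB.pack (regularization : set Y -> \bar R)
    (isOuterMeasure.Build R Y regularization regularization0 regularization_ge0
      le_regularization regularization_sigma).

(** For closed [K] inside both [W] and [U], and closed [L] inside [W] off [K], additivity of [m]
    bounds [m K + m L] by the content of [W]. The suprema over [L] and then over [K] give
    Caratheodory's inequality for open test sets. *)
Let content_add W U : open W -> open U ->
  open_content (W `&` U) + regularization (W `&` ~` U) <= open_content W.
Proof.
move=> oW oU; rewrite -leeBrDr//; apply: ge_ereal_sup => _ [K [cK KWU] <-].
rewrite leeBrDr// addrC -leeBrDr//.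
have WK : W `&` ~` U `<=` W `&` ~` K by move=> x [Wx nUx]; split=> // /KWU[].
have oWK : open (W `&` ~` K) by apply: openI => //; exact: closed_openC.
apply: le_trans (le_regularization WK) _; rewrite regularization_open//.
apply: ge_ereal_sup => _ [L [cL LW] <-]; rewrite leeBrDr// -EFinD -mU; last first.
  by rewrite eqEsubset; split=> // x [/LW[]].
apply: m_le_content; first exact: closedU.
by move=> x [/LW[]|/KWU[]].
Qed.

Let open_caratheodory U : open U -> mu.-caratheodory U.
Proof.
move=> oU; apply: le_caratheodory_measurable => E.
apply/lee_addgt0Pr => e e0; have [W [oW EW We]] := regularization_approx E e0.
apply: le_trans We; apply: le_trans (content_add oW oU).
rewrite -regularization_open; last exact: openI.
by apply: leeD; apply: le_regularization; apply: setSI.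
Qed.

Let measurable_caratheodory (B : set (borel x0)) :
  measurable B -> mu.-caratheodory B.
Proof.
move: B; apply: smallest_sub; last by move=> U; exact: open_caratheodory.
exact: (@sigma_algebra_measurable _ (caratheodory_type mu)).
Qed.

Let regularization_semi_sigma_additive :
  semi_sigma_additive (regularization : set (borel x0) -> \bar R).
Proof.
move=> F mF tF mUF; apply: (@caratheodory_measure_sigma_additive R Y mu F) => //.
- by move=> i; exact: measurable_caratheodory.
- exact: measurable_caratheodory.
Qed.

Let P0 : {measure set (borel x0) -> \bar R} :=
  HB.pack (regularization : set (borel x0) -> \bar R)
    (isMeasure.Build _ (borel x0) R regularization regularization0
      regularization_ge0 regularization_semi_sigma_additive).

Let P0T : P0 setT = 1.
Proof. by rewrite -contentT -regularization_open//; exact: openT. Qed.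

Let P : probability (borel x0) R :=
  HB.pack (regularization : set (borel x0) -> \bar R)
    P0 (Measure_isProbability.Build _ (borel x0) R P0 P0T).

Let PE A : P A = regularization A. Proof. by []. Qed.

Let P_fin A : exists a : R, regularization A = a%:E.
Proof. by exists (fine (regularization A)); rewrite fineK. Qed.

Let measurable_open U : open U -> measurable (U : set (borel x0)).
Proof. by move=> oU; exact: sub_sigma_algebra. Qed.

Let regularization_setC (B : set (borel x0)) : measurable B ->
  regularization (~` B) = 1 - regularization B.
Proof. by move=> mB; rewrite -!PE probability_setC. Qed.

Let P_regular : regular_measure P.
Proof.
move=> B mB; split; apply/eqP; rewrite eq_le; apply/andP; split.
- by apply: le_ereal_inf_tmp => _ [U [oU BU] <-]; exact: le_regularization.
- apply: le_ereal_inf_tmp => _ [U [oU BU] <-].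
  by rewrite -regularization_open//; apply: ereal_inf_lbound; exists U.
(* Inner regularity at [B] is outer regularity at its complement: the complement of an open set is
   compact. *)
- apply/lee_addgt0Pr => e e0.
  have [U [oU BU Ue]] := regularization_approx (~` B) e0.
  apply: le_trans (_ : regularization (~` U) + e%:E <= _).
    rewrite -regularization_open// in Ue; move: Ue; rewrite PE.
    rewrite regularization_setC// (regularization_setC (measurable_open oU)).
    have [u ->] := P_fin U; have [b ->] := P_fin B.
    by rewrite !lee_fin; lra.
  apply: leeD => //; apply: ereal_sup_ubound; exists (~` U) => //; split.
    by apply: subclosed_compact X_compact _ => //; exact: open_closedC.
  by move=> x nUx; apply: contrapT => nBx; apply/nUx/BU.
- apply: ge_ereal_sup => _ [K [_ KB] <-]; exact: le_regularization.
Qed.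

(** For closed [L] inside [T^-1 U], the image [T L] is compact, hence closed, and
    [m L <= m (T^-1 (T L)) = m (T L)]. So taking preimages does not increase the regularization. *)
Let P_invariant (T : X -> X) : continuous T ->
  (forall A, m (T @^-1` A) = m A) -> invariant_measure T P.
Proof.
move=> Tc Tm.
have le_open U : open U -> open_content (T @^-1` U) <= open_content U.
  move=> oU; apply: ge_ereal_sup => _ [L [cL LU] <-].
  have cTL : closed (T @` L).
    apply: compact_closed => //; apply: continuous_compact.
      exact: continuous_subspaceT.
    exact: subclosed_compact X_compact _.
  apply: le_trans (m_le_content cTL _); last by move=> _ [x Lx <-]; exact: LU.
  by rewrite lee_fin -[leRHS]Tm; apply: le_m => x Lx; exists x.
have le_pre A : regularization (T @^-1` A) <= regularization A.
  apply: le_ereal_inf_tmp => _ [U [oU AU] <-].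
  apply: le_trans (le_open U oU); apply: ereal_inf_lbound.
  exists (T @^-1` U) => //; split; last exact: preimage_subset.
  by apply: open_comp => // x _; exact: Tc.
move=> B mB; rewrite !PE; apply/eqP; rewrite eq_le le_pre /=.
(* The same inequality for the complement of [B] yields equality, as the two preimages cover a space
   of mass 1. *)
have := outer_measureU2 mu (T @^-1` B) (T @^-1` (~` B)).
rewrite -preimage_setU setUv preimage_setT.
have -> : mu setT = 1.
  by rewrite -contentT -regularization_open//; exact: openT.
have := le_pre (~` B); rewrite regularization_setC//.
have -> : mu (T @^-1` B) = regularization (T @^-1` B) by [].
have -> : mu (T @^-1` (~` B)) = regularization (T @^-1` (~` B)) by [].
have [b ->] := P_fin B; have [c ->] := P_fin (T @^-1` B).
by have [d ->] := P_fin (T @^-1` (~` B)); rewrite !lee_fin; lra.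
Qed.

Lemma regular_invariant_of_content : exists P : probability (borel x0) R,
  regular_measure P /\ forall T, continuous T ->
    (forall A, m (T @^-1` A) = m A) -> invariant_measure T P.
Proof.
by exists P; split; [exact: P_regular|move=> T Tc Tm; exact: P_invariant].
Qed.

End Regularization.

(** * Existence of an invariant measure *)

Section KrylovBogoliubov.
Variables (R : realType) (X : topologicalType) (T : X -> X) (x0 : X).
Hypotheses (X_compact : compact [set: X]) (X_hausdorff : hausdorff_space X).
Hypothesis T_continuous : continuous T.
Implicit Types (A B : set X) (n : nat).

Let hits A i : R := `[< A (iter i T x0) >]%:R.
Let freq A n : R := n.+1%:R^-1 * \sum_(i < n.+1) hits A i.

Let hits01 A i : 0 <= hits A i <= 1.
Proof. by rewrite /hits ler0n lern1 leq_b1. Qed.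

Let freq01 A n : 0 <= freq A n <= 1.
Proof.
apply/andP; split.
  by rewrite mulr_ge0 ?invr_ge0// sumr_ge0// => i _; case/andP: (hits01 A i).
rewrite /freq mulrC ler_pdivrMr// mul1r.
apply: le_trans (_ : \sum_(i < n.+1) 1 <= _); last by rewrite sumr_const card_ord.
by apply: ler_sum => i _; case/andP: (hits01 A i).
Qed.

Lemma krylov_bogoliubov : exists P : probability (borel x0) R,
  regular_measure P /\ invariant_measure T P.
Proof.
have [U [UU U00]] := ultra_nat.
(* The ultrafilter gives every subset a limiting visit frequency, and these limits inherit
   additivity. *)
have /choice[m mP] A : exists l : R, 0 <= l <= 1 /\ freq A @ U --> l.
  have [|l l01 fl] := @ultra_compact_cvg _ R U `[0, 1]%classic (freq A) UU
    (@segment_compact _ 0 1).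
    apply: (@filterS _ _ _ setT); last exact: filterT.
    by move=> n _; rewrite /= in_itv /= freq01.
  by exists l; split=> //; move: l01; rewrite /= in_itv.
have m_uniq A l : freq A @ U --> l -> m A = l.
  move=> fl; have := (mP A).2; move: fl.
  by move=> h1 h2; apply: (cvg_unique _ h2 h1); exact: norm_hausdorff.
have m_add A B : A `&` B = set0 -> m (A `|` B) = m A + m B.
  move=> AB; apply: m_uniq.
  have -> : freq (A `|` B) = fun n => freq A n + freq B n.
    apply/funext => n; rewrite /freq -mulrDr -big_split; congr (_ * _).
    apply: eq_bigr => i _; rewrite /hits asbool_or /=.
    case: asboolP => Ai; case: asboolP => Bi; rewrite ?addr0 ?add0r//.
    by have : set0 (iter i T x0) by rewrite -AB.
  by apply: cvgD; [exact: (mP A).2|exact: (mP B).2].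
have mT : m setT = 1.
  apply: m_uniq; have -> : freq setT = fun=> 1; last exact: cvg_cst.
  apply/funext => n; rewrite /freq (eq_bigr (fun=> 1)).
    by rewrite sumr_const card_ord mulVf.
  by move=> i _; rewrite /hits asboolT.
have m_inv A : m (T @^-1` A) = m A.
  apply: m_uniq.
  have -> : freq (T @^-1` A) = fun n => freq A n + (freq (T @^-1` A) n - freq A n).
    by apply/funext => n; rewrite addrC subrK.
  rewrite -[X in _ --> X]addr0; apply: cvgD; first exact: (mP A).2.
  apply/cvgrPdist_le => e e0; apply: U00.
  have : n.+1%:R^-1 @[n --> \oo] --> (0 : R) by exact: cvg_harmonic.
  move=> /cvgrPdist_le /(_ e e0); apply: filterS => n; rewrite !sub0r !normrN => ne.
  apply: le_trans ne; rewrite -mulrBr normrM -[leRHS]mulr1 ler_wpM2l//.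
  (* The two sums differ by a shift of the index; only one term at each end survives, so the
     frequencies differ by at most [1 / (n + 1)]. *)
  have -> : \sum_(i < n.+1) hits (T @^-1` A) i = \sum_(i < n.+1) hits A i.+1 by [].
  rewrite big_ord_recr [X in _ - X]big_ord_recl /= [X in _ - X]addrC opprD addrACA -sumrB.
  rewrite big1 ?add0r; last by move=> i _; rewrite subrr.
  have := hits01 A n.+1; have := hits01 A 0; rewrite ler_norml; lra.
have [P [Pr Pi]] := regular_invariant_of_content x0 X_compact X_hausdorff
  (fun A => (andP (mP A).1).1) m_add mT.
by exists P; split=> //; exact: Pi.
Qed.
End KrylovBogoliubov.

(** * Borel measurability of continuous maps *)

Section BorelMeasurability.
Variables (R : realType) (X : topologicalType) (x0 : X).

Lemma open_borel (U : set X) : open U -> measurable (U : set (borel x0)).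
Proof. by move=> oU; exact: sub_sigma_algebra. Qed.

Lemma closed_borel (K : set X) : closed K -> measurable (K : set (borel x0)).
Proof.
by move=> cK; have := measurableC (open_borel (closed_openC cK)); rewrite setCK.
Qed.

Lemma continuous_borel (f : X -> R) : continuous f ->
  measurable_fun setT (f : borel x0 -> R).
Proof.
move=> fc; apply: (measurability _ (measurable_realfun.RGenOpens.measurableE R)).
move=> _ [_ [a [b ->]] <-]; rewrite setTI; apply: open_borel.
by apply: open_comp => [x _|]; [exact: fc|exact: interval_open].
Qed.

Lemma continuous_borel_self (T : X -> X) : continuous T ->
  measurable_fun setT (T : borel x0 -> borel x0).
Proof.
move=> Tc; apply: (@measurability _ _ (borel x0) (borel x0) setT T
  (@open (pointed_at x0))) => //.
move=> _ [U oU <-]; rewrite setTI; apply: open_borel.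
by apply: open_comp; [move=> x _; exact: Tc|exact: oU].
Qed.
End BorelMeasurability.

(** * Uniqueness from uniform Birkhoff averages *)

Section Uniqueness.
Variables (R : realType) (X : topologicalType) (T : X -> X) (x0 : X).
Hypotheses (X_hausdorff : hausdorff_space X) (T_continuous : continuous T).
Implicit Types (nu : probability (borel x0) R) (f : X -> R).

Let Tm : measurable_fun setT (T : borel x0 -> borel x0).
Proof. exact: continuous_borel_self. Qed.

Let iterT_continuous i : continuous (iter i T).
Proof.
elim: i => [|i IH] x; first exact: cvg_id.
by apply: (@continuous_comp _ _ _ (iter i T) T); [exact: IH|exact: T_continuous].
Qed.

Let integral_iter nu f i : invariant_measure T nu -> continuous f ->
  (forall x, 0 <= f x) ->
  (\int[nu]_x (f (iter i T x))%:E = \int[nu]_x (f x)%:E)%E.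
Proof.
move=> inv fc f0; elim: i => // i <-.
have mf : measurable_fun setT (EFin \o (fun x : borel x0 => f (iter i T x))).
  apply/measurable_EFinP; apply: (@continuous_borel R X x0 (f \o iter i T)).
  by move=> x; apply: continuous_comp; [exact: iterT_continuous|exact: fc].
transitivity (\int[pushforward nu (T : borel x0 -> borel x0)]_x (f (iter i T x))%:E)%E.
  rewrite ge0_integral_pushforward//.
    by apply: eq_integral => x _; rewrite /= -iterSr.
  by move=> x _; rewrite lee_fin.
by apply: eq_measure_integral => A mA _; exact: inv.
Qed.

(** By invariance the [N] terms of the Birkhoff sum have equal integrals, so integrating the uniform
    estimate and dividing by [N] localizes the integral of [f]. *)
Let average_bound nu f (c e : R) (N : nat) : invariant_measure T nu ->
  continuous f -> (forall x, 0 <= f x) -> (0 < N)%N ->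
  (forall x, `|\sum_(i < N) f (iter i T x) - c * N%:R| <= e * N%:R) ->
  ((c - e)%:E <= \int[nu]_x (f x)%:E <= (c + e)%:E)%E.
Proof.
move=> inv fc f0 N0 fN; have NR : 0 < N%:R :> R by rewrite ltr0n.
have mfi i : measurable_fun setT (EFin \o (fun x : borel x0 => f (iter i T x))).
  apply/measurable_EFinP; apply: (@continuous_borel R X x0 (f \o iter i T)).
  by move=> x; apply: continuous_comp; [exact: iterT_continuous|exact: fc].
have intN : (\int[nu]_x (\sum_(i < N) f (iter i T x))%:E =
    N%:R%:E * \int[nu]_x (f x)%:E)%E.
  under eq_integral do rewrite -sumEFin.
  have f0i (i : 'I_N) (x : borel x0) : setT x -> (0 <= (f (iter i T x))%:E)%E.
    by move=> _; rewrite lee_fin.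
  rewrite (ge0_integral_sum nu measurableT (fun i : 'I_N => mfi i) f0i).
  rewrite (eq_bigr (fun=> \int[nu]_x (f x)%:E)%E); last first.
    by move=> i _; exact: integral_iter.
  by rewrite sumr_const card_ord mule_natl.
have I0 : (0 <= \int[nu]_x (f x)%:E)%E.
  by apply: integral_ge0 => x _; rewrite lee_fin.
have mS : measurable_fun setT
    (EFin \o (fun x : borel x0 => \sum_(i < N) f (iter i T x))).
  apply/measurable_EFinP; apply: measurable_sum => i.
  by have /measurable_EFinP := mfi i.
have S0 x : 0 <= \sum_(i < N) f (iter i T x) by rewrite sumr_ge0.
have intC (k : R) : (\int[nu]_x (cst k%:E x) = k%:E)%E.
  rewrite integral_cst//; transitivity (k%:E * 1)%E; last by rewrite mule1.
  by congr (_ * _)%E; exact: probability_setT.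
have up : (\int[nu]_x (\sum_(i < N) f (iter i T x))%:E <= ((c + e) * N%:R)%:E)%E.
  rewrite -[leRHS]intC; apply: ge0_le_integral => //.
  - by move=> x _; rewrite lee_fin.
  - by move=> x _; rewrite lee_fin; have := fN x; rewrite ler_norml; lra.
have lo : (((c - e) * N%:R)%:E <= \int[nu]_x (\sum_(i < N) f (iter i T x))%:E)%E.
  (* The integrals are compared for nonnegative functions, while [c - e] may be negative. *)
  apply: le_trans (_ : (Num.max ((c - e) * N%:R) 0)%:E <= _)%E.
    by rewrite lee_fin le_max lexx.
  rewrite -[leLHS]intC; apply: ge0_le_integral => //.
  - by move=> x _; rewrite lee_fin le_max lexx orbT.
  - move=> x _; rewrite lee_fin ge_max S0 andbT.
    by have := fN x; rewrite ler_norml; lra.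
move: I0 up lo; rewrite intN.
(* An infinite integral would contradict [I0] or [up]. *)
case: (\int[nu]_x (f x)%:E)%E => [I| |] //.
  rewrite -EFinM !lee_fin => I0 up lo.
  rewrite -(ler_pM2r NR) (le_trans lo) 1?mulrC//=.
  by rewrite -(ler_pM2r NR) mulrC.
by move=> _; rewrite gt0_muley ?lte_fin.
Qed.

Let integral_sandwich nu f (K U : set X) : continuous f -> closed K -> open U ->
  (forall x, 0 <= f x <= 1) -> (forall x, K x -> f x = 1) ->
  (forall x, ~ U x -> f x = 0) ->
  (nu K <= \int[nu]_x (f x)%:E <= nu U)%E.
Proof.
move=> fc cK oU f01 fK fU.
have mK := @closed_borel X x0 _ cK; have mU := @open_borel X x0 _ oU.
have mf : measurable_fun setT (EFin \o (f : borel x0 -> R)).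
  by apply/measurable_EFinP; exact: (@continuous_borel R X x0 f fc).
have mI (B : set (borel x0)) : measurable B ->
    measurable_fun setT (EFin \o (\1_B : borel x0 -> R)).
  by move=> mB; apply/measurable_EFinP/measurable_indic.
apply/andP; split.
- rewrite -[K]setIT -integral_indic//; apply: ge0_le_integral => //.
  + exact: mI.
  + move=> x _; rewrite lee_fin indicE; case: (boolP (x \in K)) => [|_].
      by rewrite inE => /fK ->.
    by case/andP: (f01 x).
- rewrite -[U]setIT -integral_indic//; apply: ge0_le_integral => //.
  + by move=> x _; rewrite lee_fin; case/andP: (f01 x).
  + exact: mI.
  + move=> x _; rewrite lee_fin indicE; case: (boolP (x \in U)) => [_|].
      by case/andP: (f01 x).
    by move=> /negP; rewrite inE => /fU ->.
Qed.

(* Oxtoby's criterion, for just enough test functions to separate closed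
   sets; no density in C(X) is needed. *)
Lemma regular_invariant_unique :
  (forall K U : set X, closed K -> open U -> K `<=` U ->
    exists f : X -> R, [/\ continuous f, (forall x, 0 <= f x <= 1),
      (forall x, K x -> f x = 1), (forall x, ~ U x -> f x = 0) &
      forall e : R, 0 < e -> exists (c : R) (N : nat), (0 < N)%N /\
        forall x, `|\sum_(i < N) f (iter i T x) - c * N%:R| <= e * N%:R]) ->
  forall nu1 nu2 : probability (borel x0) R,
    regular_measure nu1 -> invariant_measure T nu1 ->
    regular_measure nu2 -> invariant_measure T nu2 ->
    forall B : set (borel x0), measurable B -> nu1 B = nu2 B.
Proof.
move=> sep.
(* With [K] closed in [U], [nu1 K] is at most the [nu1]-integral of [f], this is within [e] of the
   [nu2]-integral since both are within [e / 2] of the same [c], and the latter is at most [nu2 U].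
   Inner regularity lets [K] exhaust [U]. *)
have le_open (nu1 nu2 : probability (borel x0) R) :
    regular_measure nu1 -> invariant_measure T nu1 -> invariant_measure T nu2 ->
    forall U : set X, open U -> (nu1 U <= nu2 U)%E.
  move=> reg1 inv1 inv2 U oU.
  rewrite (reg1 U (@open_borel X x0 U oU)).2; apply: ge_ereal_sup => _ [K [cK KU] <-].
  have {}cK : closed K by exact: compact_closed.
  have [f [fc f01 fK fU fN]] := sep K U cK oU KU.
  apply/lee_addgt0Pr => e e0.
  have [c [N [N0 cN]]] := fN (e / 2) (divr_gt0 e0 (ltr0Sn _ _)).
  have f0 x : 0 <= f x by case/andP: (f01 x).
  have /andP[_ h1] := average_bound inv1 fc f0 N0 cN.
  have /andP[h2 _] := average_bound inv2 fc f0 N0 cN.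
  have /andP[h3 _] := integral_sandwich nu1 fc cK oU f01 fK fU.
  have /andP[_ h4] := integral_sandwich nu2 fc cK oU f01 fK fU.
  apply: le_trans (le_trans h3 h1) _.
  rewrite (_ : c + e / 2 = c - e / 2 + e); last by field.
  by rewrite EFinD leeD2r// (le_trans h2).
move=> nu1 nu2 reg1 inv1 reg2 inv2 B mB.
(* Outer regularity reduces to open sets, where the inequality holds in both directions. *)
rewrite (reg1 B mB).1 (reg2 B mB).1; congr ereal_inf.
apply: eq_imagel => U [oU _]; apply/eqP.
by rewrite eq_le !le_open.
Qed.
End Uniqueness.

(** * Test functions on the subshift and unique ergodicity *)

Lemma val_iter_subshift_map (A : topologicalType) (rho : substitution A) i
    (x : subshift rho) :
  val (iter i (@subshift_map A rho) x) = iter i (@left_shift A) (val x).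
Proof. by elim: i => //= i ->. Qed.

(** Urysohn's lemma is applied in the space of all sequences, to [K] and the complement of an open
    [V] that cuts out [U]; the function is then defined on all sequences, as [uniform_averages]
    demands. *)
Lemma subshift_separation (R : realType) (A : compactHausdorffType)
    (rho : substitution A) (K U : set (subshift rho)) :
  closed K -> open U -> K `<=` U ->
  exists G : {ptws int -> A} -> R, [/\ continuous G, (forall x, 0 <= G x <= 1),
    (forall x, K x -> G (val x) = 1) & (forall x, ~ U x -> G (val x) = 0)].
Proof.
move=> cK [V oV VU] KU.
have cVK : closed (set_val @` K : set {ptws int -> A}).
  apply: compact_closed; first exact: hausdorff_sequences.
  apply: continuous_compact.
    by apply: continuous_subspaceT; exact: initial_continuous.
  by apply: subclosed_compact (@subshift_compact A rho) _.
have cV : closed (~` V) by exact: open_closedC.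
have disj : (~` V) `&` (set_val @` K) = set0.
  rewrite eqEsubset; split=> // y [nV [x Kx xy]]; apply: nV.
  by rewrite -xy; have := KU x Kx; rewrite -VU.
have nZ : normal_space {ptws int -> A}.
  by apply: compact_normal; [exact: hausdorff_sequences|exact: compact_sequences].
have := (@normal_separatorP R {ptws int -> A}).1 nZ _ _ cV cVK disj.
move=> /(@uniform_separatorP _ R) [G [Gc G01 G0 G1]]; exists G; split=> //.
- by move=> x; have := G01 (G x) (ex_intro2 _ _ x I erefl); rewrite /= in_itv.
- by move=> x Kx; apply: G1; exists (val x) => //; exists x.
- by move=> x nUx; apply: G0; exists (val x) => //= Vx; apply: nUx; rewrite -VU.
Qed.

Theorem theorem1p1 (R : realType) (A : compactHausdorffType)
    (rho : substitution A)
    (rho_long : exists a : A, (2 <= size (rho a))%N)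
    (rho_primitive : primitive_subst rho) :
  let M : cfun R A -> cfun R A := subst_op rho in
  let r : R := spectral_radius M in
  strongly_power_convergent (fun f : cfun R A => r^-1 *: M f) ->
  uniquely_ergodic R (@subshift_map A rho).
Proof.
move=> M r T_conv; have [a _] := rho_long.
(* Long iterates provide a point of the subshift, which serves both as the base point of [borel] and
   as the start of the orbit for the empirical measures. *)
have sizes N : exists n, forall b, (N <= size (subst_iter rho n b))%N.
  apply: (@filter_ex _ \oo).
  exact: (size_subst_iter_large rho_long rho_primitive T_conv).
have [z zX] := subshift_nonempty a sizes.
pose x0 : subshift rho := exist _ z (mem_set zX).
have cX := @subshift_compact A rho; have hX := @subshift_hausdorff A rho.
have Tc := @subshift_map_continuous A rho.
have [mu [mu_reg mu_inv]] := krylov_bogoliubov R x0 cX hX Tc.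
exists x0, mu; split=> // nu nu_reg nu_inv.
apply: (regular_invariant_unique hX Tc) => // K U cK oU KU.
have [G [Gc G01 GK GU]] := subshift_separation R cK oU KU.
exists (G \o val); split=> //.
- by move=> x; apply: continuous_comp; [exact: initial_continuous|exact: Gc].
- by move=> x; exact: G01.
move=> e e0.
have [c [N [N0 cN]]] := uniform_averages a
  (quasi_additive_language rho_long rho_primitive T_conv) Gc e0.
exists c, N; split=> // x; have := cN _ (set_valP x).
rewrite (eq_bigr (fun i : 'I_N => G (val (iter i (@subshift_map A rho) x)))) //.
by move=> i _; rewrite val_iter_subshift_map.
Qed.
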